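(* For $b\le 3.06$, $$\min_{z\in\overline{\mathcal{D}_{\mathcal{G}}}}\big(\zeta(6,z)-b\zeta(3,z)\big)=\min_{z\in\Gamma_b}\big(\zeta(6,z)-b\zeta(3,z)\big).$$
   Context: For $s>1$ and $z\in\mathbb{H}=\{\Im z>0\}$, $\zeta(s,z)=\sum_{(m,n)\in\mathbb{Z}^2\setminus\{0\}}\frac{(\Im z)^s}{|mz+n|^{2s}}$. $\mathcal{D}_{\mathcal{G}}=\{z\in\mathbb{H}: |z|>1,\ 0<\Re z<\frac12\}$. $\Gamma_b=\{z\in\mathbb{H}: |z|=1,\ \Im z\in[\frac{\sqrt3}{2},1]\}$. *)

(* Defs.v *)
From HB Require Import structures.
From mathcomp Require Import all_boot all_order all_algebra.
From mathcomp Require Import all_classical all_reals all_analysis.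
Set Implicit Arguments. Unset Strict Implicit. Unset Printing Implicit Defensive.
Import Order.TTheory GRing.Theory Num.Theory.
Import numFieldNormedType.Exports.
Local Open Scope classical_set_scope.
Local Open Scope ring_scope.

(* A point z = x + i y of the plane is represented as the pair (x, y) : R * R. *)

(* |m z + n|^2 for z = (x, y). *)
Definition latnorm2 {R : realType} (z : R * R) (m n : int) : R :=
  (m%:~R * z.1 + n%:~R) ^+ 2 + (m%:~R * z.2) ^+ 2.

(* Epstein zeta function
     zeta(s, z) = sum_{(m,n) in Z^2 \ {0}} (Im z)^s / |m z + n|^(2 s),
   defined as the (unordered, nonnegative) sum over Z^2 \ {0}, read back
   as a real number (the sum is finite for s > 1 and Im z > 0). *)
Definition epstein_zeta {R : realType} (s : R) (z : R * R) : R :=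
  fine (\esum_(p in [set p : int * int | p != (0, 0)])
          ((z.2 `^ s) / ((latnorm2 z p.1 p.2) `^ s))%:E).

Definition DG {R : realType} : set (R * R) :=
  [set z | 0 < z.2 /\ 1 < z.1 ^+ 2 + z.2 ^+ 2 /\ 0 < z.1 /\ z.1 < 2^-1].

Definition Gamma_b {R : realType} : set (R * R) :=
  [set z | 0 < z.2 /\ z.1 ^+ 2 + z.2 ^+ 2 = 1 /\
           Num.sqrt 3 / 2 <= z.2 /\ z.2 <= 1].

Definition is_min_on {T : Type} {R : realType} (f : T -> R) (A : set T) (m : R) :=
  (exists2 z, A z & f z = m) /\ (forall w, A w -> m <= f w).

(* Main.v *)
From Stdlib Require ZArith.
Require Import Defs.
From HB Require Import structures.
From mathcomp Require Import all_boot all_order all_algebra.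
From mathcomp Require Import all_classical all_reals all_analysis.
From mathcomp Require Import zify ring lra ssrZ.
Import Order.TTheory GRing.Theory Num.Theory.
Import numFieldNormedType.Exports.
Local Open Scope classical_set_scope.
Local Open Scope ring_scope.

(** Write z = r (k + i h) with k^2 + h^2 = 1, so that zeta(s, z) = h^s S_s(r, k),
    where S_s(r, k) is the sum of the (r m^2 + 2 k m n + n^2 / r)^(-s).  On the
    closure of D_G one has r >= 1, 0 <= k <= 1/2 and 2 k r <= 1, and z is compared
    with the point z / r of the arc: both S_3 and h^6 S_6 - 3.06 h^3 S_3 are at least
    as large at r as at 1, which gives the claim for every b <= 3.06 since the energy
    is affine in b.

    Pairing (m, n) with (n, m) makes S_s even in log r, so that its increment is
    u times a function of u = (r - 1)^2 / (2 r).  Tangent-line bounds for x^(-s) give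
    explicit bounds of the two increments divided by u: a finite sum over
    max(|m|, |n|) <= N, and a tail that is O(N^(-4)).  The remaining inequality in
    (k, u) is a comparison of polynomials for u >= 1/5.  For u <= 1/5 it is checked by
    interval arithmetic and bisection; it is nearly an equality at the hexagonal point
    (k, u) = (1/2, 0), where the second variation of the energy vanishes for
    b = 3.0611..., and there N = 11 is needed. *)

(** * Sums over the nonzero lattice points *)

(** Write r = exp x, so that u = cosh x - 1. In the terms of (m, n) and (n, m) together the parts
    linear in sinh x cancel, and sinh^2 x = u (2 + u); hence the linear and the quadratic parts of a
    Taylor bound both carry a factor u. Dividing by u is essential: on the arc the undivided
    inequality reads 0 <= 0, which no interval computation could certify on a neighbourhood. The
    Taylor remainders involve the ratio of the form at r to the form at 1; one number t bounds all
    these ratios at once. On the axes the increments stay exact, which keeps the bounds usable when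
    u is large. The truncation is uneven: the terms of S_6 decay like the twelfth inverse power of
    the norm, so N = 4 always suffices there, and only the bound of S_3 ever uses N = 11. The factor
    h^3 contains a square root of 1 - k^2, hence the final comparison of squares. The monotonicity
    of S_3 has ample room: convexity and the axis terms give it. That the minimum is attained is a
    separate point: the energy on the arc is continuous in k, by a Lipschitz bound drawn from the
    same comparison of lattice sums. *)

Definition nonzero : set (int * int) := [set p | p != 0].

Definition supnorm (p : int * int) : nat := maxn `|p.1| `|p.2|.

Definition zrange (N : nat) : seq int :=
  [seq i%:Z - N%:Z | i <- iota 0 (N.*2.+1)].

Definition square (N : nat) : seq (int * int) :=
  [seq (i, j) | i <- zrange N, j <- zrange N].

Definition punctured (N : nat) : seq (int * int) :=
  [seq p <- square N | p != 0].

Lemma mem_zrange N (i : int) : (i \in zrange N) = (`|i| <= N)%N.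
Proof.
apply/mapP/idP => [[j]|iN]; first by rewrite mem_iota => ? ->; lia.
by exists (absz (i + N%:Z)); rewrite ?mem_iota; lia.
Qed.

Lemma zrange_uniq N : uniq (zrange N).
Proof. by rewrite map_inj_uniq ?iota_uniq// => i j; lia. Qed.

Lemma mem_square N p : (p \in square N) = (supnorm p <= N)%N.
Proof.
rewrite /supnorm geq_max -!mem_zrange; case: p => a b /=.
apply/allpairsP/idP => [[[x y] /= [xN yN [-> ->]]]|/andP[aN bN]]; first by rewrite xN.
by exists (a, b).
Qed.

Lemma square_uniq N : uniq (square N).
Proof. by apply: allpairs_uniq => [||[a b] [c d] //]; exact: zrange_uniq. Qed.

Lemma size_square N : size (square N) = (N.*2.+1 ^ 2)%N.
Proof. by rewrite size_allpairs !size_map size_iota. Qed.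

Lemma mem_punctured N p :
  (p \in punctured N) = (p != 0) && (supnorm p <= N)%N.
Proof. by rewrite mem_filter mem_square. Qed.

Lemma punctured_uniq N : uniq (punctured N).
Proof. exact: filter_uniq (square_uniq N). Qed.

Lemma supnorm_eq0 p : (supnorm p == 0)%N = (p == 0).
Proof.
case: p => a b; have -> : ((a, b) == 0) = (a == 0) && (b == 0) by [].
by rewrite /supnorm /=; lia.
Qed.

Lemma supnorm_gt0 p : (0 < supnorm p)%N = (p != 0).
Proof. by rewrite lt0n supnorm_eq0. Qed.

Section LatticeSums.
Context {R : realType}.
Implicit Types (F G : int * int -> R) (B C : R).

Definition lattice_sum F : R :=
  fine (\esum_(p in nonzero) (F p)%:E).

Definition nonneg F := forall p, p != 0 -> 0 <= F p.

(** [fine] sends an infinite sum to 0, so [lattice_sum F] carries information only together with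
    such a bound. Squares suffice because they exhaust the lattice. *)
Definition summed_by F B := forall N, \sum_(p <- punctured N) F p <= B.

Lemma punctured_split M N F : (N <= M)%N ->
  \sum_(p <- punctured M) F p =
  \sum_(p <- punctured N) F p + \sum_(p <- square M | (N < supnorm p)%N) F p.
Proof.
move=> NM; rewrite big_filter (bigID (fun p => (supnorm p <= N)%N))/=; congr (_ + _).
  rewrite -big_filter; apply: perm_big; apply: uniq_perm.
  - exact/filter_uniq/square_uniq.
  - exact: punctured_uniq.
  move=> p; rewrite mem_filter mem_square mem_punctured -andbA.
  by case: (leqP (supnorm p) N) => [/leq_trans->|]; rewrite ?andbF ?andbT.
apply: eq_bigl => p; rewrite -ltnNge -supnorm_gt0 andb_idl// => pN.
exact: leq_ltn_trans pN.
Qed.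

(** The extended sum is the supremum of the finite subsums, and every finite set of indices lies in
    some square. *)
Lemma esum_le_summed F B : nonneg F -> summed_by F B ->
  (\esum_(p in nonzero) (F p)%:E <= B%:E)%E.
Proof.
move=> F0 FB; apply: ge_ereal_sup => _ [/= X [finX X0] <-].
rewrite fsbig_finite//= sumEFin lee_fin.
set Y := finmap.enum_fset _.
have YX p : p \in Y -> p != 0.
  by move=> pY; apply: X0; rewrite -in_setE -in_fset_set.
pose M := (\max_(p <- Y) supnorm p)%N.
apply: le_trans (FB M).
rewrite [leRHS](bigID (mem Y))/= -[leLHS]addr0 lerD//; last first.
  rewrite big_seq_cond; apply: sumr_ge0 => p /andP[+ _].
  by rewrite mem_punctured => /andP[/F0].
rewrite le_eqVlt; apply/orP; left; apply/eqP.
rewrite -[RHS]big_filter; apply: perm_big; apply: uniq_perm.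
- exact: finmap.fset_uniq.
- exact/filter_uniq/punctured_uniq.
move=> p; rewrite mem_filter mem_punctured.
case: (boolP (p \in Y)) => //= pY.
by rewrite YX//=; apply/esym; exact: leq_bigmax_seq.
Qed.

Lemma esum_fin_num F B : nonneg F -> summed_by F B ->
  (\esum_(p in nonzero) (F p)%:E) \is a fin_num.
Proof.
move=> F0 FB; rewrite ge0_fin_numE; last first.
  by apply: esum_ge0 => p /F0; rewrite lee_fin.
exact: le_lt_trans (esum_le_summed _ _ F0 FB) (ltry _).
Qed.

Lemma lattice_sum_le F B : nonneg F -> summed_by F B -> lattice_sum F <= B.
Proof.
move=> F0 FB; rewrite -lee_fin fineK ?(esum_fin_num _ _ F0 FB)//.
exact: esum_le_summed.
Qed.

Lemma sum_le_lattice_sum F B : nonneg F -> summed_by F B ->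
  summed_by F (lattice_sum F).
Proof.
move=> F0 FB N; rewrite -lee_fin fineK ?(esum_fin_num _ _ F0 FB)//.
apply: esum_ge; exists [set` punctured N].
  by split => [|p /=]; [exact: finite_seq|rewrite mem_punctured => /andP[]].
rewrite -fsbig_seq ?punctured_uniq// sumEFin; exact: lexx.
Qed.

End LatticeSums.

Lemma count_shell M :
  count (fun p => (M < supnorm p)%N) (square M.+1) = (8 * M.+1)%N.
Proof.
have := count_predC (fun p => (supnorm p <= M)%N) (square M.+1).
rewrite -size_filter (_ : size _ = size (square M)); last first.
  apply: perm_size; apply: uniq_perm; [exact/filter_uniq/square_uniq|exact: square_uniq|].
  by move=> p; rewrite mem_filter !mem_square; case: leqP => //= /leqW.
rewrite !size_square (eq_count (a2 := fun p => M < supnorm p)%N); last first.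
  by move=> p /=; rewrite ltnNge.
nia.
Qed.

Section Comparison.
Context {R : realType}.
Implicit Types (F G : int * int -> R) (B C : R).

Lemma sum_square_supnorm_ext M N F : (N <= M)%N ->
  \sum_(p <- square M.+1 | (N < supnorm p)%N) F p =
  \sum_(p <- square M | (N < supnorm p)%N) F p +
  \sum_(p <- square M.+1 | (M < supnorm p)%N) F p.
Proof.
move=> NM; have := punctured_split M.+1 N F (leqW NM).
rewrite (punctured_split M.+1 M F (leqnSn M)) (punctured_split M N F NM) -addrA.
by move=> /addrI ->.
Qed.

(** The shell of sup-norm n has 8 n points and contributes 8 / n^5. This is at most the decrease of
    2 / (n (n + 1))^2 from n - 1 to n, so the sum telescopes. *)
Lemma sum_supnorm_tail N M : (0 < N <= M)%N ->
  \sum_(p <- square M | (N < supnorm p)%N) (supnorm p)%:R^-1 ^+ 6 <=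
  2 / (N%:R * N.+1%:R) ^+ 2 :> R.
Proof.
pose g n : R := 2 / (n%:R * n.+1%:R) ^+ 2.
move=> /andP[N0 NM]; rewrite -/(g N).
suff : \sum_(p <- square M | (N < supnorm p)%N) (supnorm p)%:R^-1 ^+ 6 <= g N - g M.
  by move=> /le_trans; apply; rewrite lerBlDr lerDl divr_ge0// exprn_ge0.
elim: M NM => [|M IH]; first by rewrite leqn0 => /eqP N_0; rewrite N_0 in N0.
rewrite leq_eqVlt => /predU1P[->|NM].
  rewrite subrr big_seq_cond big1// => p /andP[]; rewrite mem_square; lia.
have M0 : (0 < M)%N by exact: leq_trans N0 _.
rewrite sum_square_supnorm_ext//.
rewrite (_ : g N - g M.+1 = (g N - g M) + (g M - g M.+1)); last by ring.
apply: lerD; first exact: IH.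
rewrite big_seq_cond.
rewrite (eq_bigr (fun=> M.+1%:R^-1 ^+ 6)); last first.
  move=> p /andP[]; rewrite mem_square => p1 p2.
  by have -> : supnorm p = M.+1 by lia.
rewrite -big_seq_cond big_const_seq count_shell iter_addr addr0.
rewrite -[_ *+ (8 * _)]mulr_natr natrM /g -!natr1.
have : 0 < M%:R :> R by rewrite ltr0n.
have : 1 <= M%:R :> R by rewrite ler1n.
move: (M%:R : R) => x x1 x0.
rewrite -subr_ge0 (_ : _ - _ = 8 * (2 * (x + 1) ^+ 2 - 1)
    / ((x + 1) ^+ 5 * (x * (x + 1 + 1)) ^+ 2)); last first.
  by field; rewrite !lt0r_neq0//; lra.
apply: divr_ge0; first by nra.
by apply: mulr_ge0; apply: exprn_ge0; nra.
Qed.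

Definition dominated F G C N := forall p, (N < supnorm p)%N ->
  F p <= G p + C * (supnorm p)%:R^-1 ^+ 6.

(** Two infinite sums are compared without forming the series of differences: inside the square of
    radius N the differences are kept term by term, outside they cost C times the explicit tail of
    the sixth powers. *)
Lemma summed_by_compare N C F G B : (0 < N)%N -> 0 <= C ->
  nonneg F -> nonneg G -> summed_by G B -> dominated F G C N ->
  summed_by F (lattice_sum G + \sum_(p <- punctured N) (F p - G p)
               + C * (2 / (N%:R * N.+1%:R) ^+ 2)).
Proof.
move=> N0 C0 F0 G0 GB FG.
suff H M : (N <= M)%N -> \sum_(p <- punctured M) F p <= lattice_sum G +
    \sum_(p <- punctured N) (F p - G p) + C * (2 / (N%:R * N.+1%:R) ^+ 2).
  move=> M; case: (leqP N M) => [/H//|/ltnW MN].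
  apply: le_trans (H N (leqnn N)).
  rewrite (punctured_split N M F MN) lerDl big_seq_cond.
  apply: sumr_ge0 => p /andP[_ Mp]; apply: F0.
  by rewrite -supnorm_gt0; exact: leq_ltn_trans Mp.
move=> NM; have GM := sum_le_lattice_sum G B G0 GB M.
rewrite (punctured_split M N F NM) sumrB.
rewrite (punctured_split M N G NM) in GM.
have T := sum_supnorm_tail N M; rewrite N0 NM in T; have {}T := T isT.
have arith (sf tf sg tg l w k : R) :
  tf <= tg + w -> w <= k -> sg + tg <= l -> sf + tf <= l + (sf - sg) + k by lra.
apply: arith (ler_wpM2l C0 T) GM.
by rewrite mulr_sumr -big_split; apply: ler_sum => p /FG.
Qed.

Lemma lattice_sum_compare N C F G B : (0 < N)%N -> 0 <= C ->
  nonneg F -> nonneg G -> summed_by G B -> dominated F G C N ->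
  lattice_sum F <= lattice_sum G + \sum_(p <- punctured N) (F p - G p)
               + C * (2 / (N%:R * N.+1%:R) ^+ 2).
Proof.
by move=> N0 C0 F0 G0 GB FG; apply: lattice_sum_le => //; exact: summed_by_compare FG.
Qed.

Lemma summed_by_supnorm C F : 0 <= C -> nonneg F ->
  (forall p, p != 0 -> F p <= C * (supnorm p)%:R^-1 ^+ 6) ->
  exists B, summed_by F B.
Proof.
move=> C0 F0 FC; eexists.
apply: (@summed_by_compare 1 C F (fun=> 0) 0) => // [N|p p1].
  by rewrite big1.
by rewrite add0r FC// -supnorm_gt0; exact: ltnW.
Qed.

Lemma eq_lattice_sum F G : (forall p, p != 0 -> F p = G p) ->
  lattice_sum F = lattice_sum G.
Proof. by move=> FG; congr fine; apply: eq_esum => p /FG ->. Qed.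

Lemma lattice_sumD F G B B' : nonneg F -> nonneg G ->
  summed_by F B -> summed_by G B' ->
  lattice_sum (fun p => F p + G p) = lattice_sum F + lattice_sum G.
Proof.
move=> F0 G0 FB GB; rewrite /lattice_sum; under eq_esum do rewrite EFinD.
rewrite esumD ?fineD ?(esum_fin_num _ _ F0 FB) ?(esum_fin_num _ _ G0 GB)//.
Qed.

Lemma lattice_sumZ a F B : 0 < a -> nonneg F -> summed_by F B ->
  lattice_sum (fun p => a * F p) = a * lattice_sum F.
Proof.
move=> a0 F0 FB.
have aF0 : nonneg (fun p => a * F p) by move=> p /F0; apply: mulr_ge0; exact: ltW.
have aFB : summed_by (fun p => a * F p) (a * B).
  by move=> N; rewrite -mulr_sumr ler_pM2l.
apply/eqP; rewrite eq_le; apply/andP; split.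
  apply: lattice_sum_le => // N; rewrite -mulr_sumr ler_pM2l//.
  exact: sum_le_lattice_sum FB N.
rewrite -ler_pdivlMl//; apply: lattice_sum_le => // N; rewrite ler_pdivlMl// mulr_sumr.
exact: sum_le_lattice_sum aFB N.
Qed.

Lemma lattice_sum_bij (f : int * int -> int * int) F : injective f ->
  (forall p, supnorm (f p) = supnorm p) ->
  (forall q, exists p, f p = q) ->
  lattice_sum (F \o f) = lattice_sum F.
Proof.
move=> fI fs fsurj; rewrite /lattice_sum [in RHS](reindex_esum nonzero nonzero f)//.
split=> [p /= |p q _ _ /fI//|q].
- by rewrite /nonzero/= -!supnorm_gt0 fs.
- have [p <-] := fsurj q; rewrite /nonzero /= -supnorm_gt0 fs supnorm_gt0 => p0.
  by exists p.
Qed.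

End Comparison.

(** * Quadratic forms and tangent-line bounds *)

Section Forms.
Context {R : realFieldType}.
Implicit Types (x y t r k m n : R).

(** Exact remainder of the expansion of x^(-s) at y: the powers s, ..., 1 of y / x occur with
    coefficients 1, ..., s. These add up to s (s + 1) / 2, whence the constants 6 for s = 3 and 21
    for s = 6 in the bounds below. *)
Lemma inv3_tangent x y : 0 < x -> 0 < y ->
  x^-1 ^+ 3 - (y^-1 ^+ 3 - 3 * (x - y) * y^-1 ^+ 4) =
  (x - y) ^+ 2 * y^-1 ^+ 5 * ((y / x) ^+ 3 + 2 * (y / x) ^+ 2 + 3 * (y / x)).
Proof. by move=> x0 y0; field; rewrite !gt_eqF. Qed.

Lemma inv6_tangent x y : 0 < x -> 0 < y ->
  x^-1 ^+ 6 - (y^-1 ^+ 6 - 6 * (x - y) * y^-1 ^+ 7) =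
  (x - y) ^+ 2 * y^-1 ^+ 8 * ((y / x) ^+ 6 + 2 * (y / x) ^+ 5 + 3 * (y / x) ^+ 4
    + 4 * (y / x) ^+ 3 + 5 * (y / x) ^+ 2 + 6 * (y / x)).
Proof. by move=> x0 y0; field; rewrite !gt_eqF. Qed.

Lemma inv3_ge_tangent x y : 0 < x -> 0 < y ->
  y^-1 ^+ 3 - 3 * (x - y) * y^-1 ^+ 4 <= x^-1 ^+ 3.
Proof.
move=> x0 y0; rewrite -subr_ge0 inv3_tangent//.
have w0 : 0 <= y / x by rewrite divr_ge0 ?ltW.
apply: mulr_ge0; first by rewrite mulr_ge0 ?sqr_ge0 ?exprn_ge0 ?invr_ge0 ?ltW.
by move: (y / x) w0 => w w0; rewrite !addr_ge0 ?mulr_ge0 ?exprn_ge0.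
Qed.

Lemma inv3_le_tangent t x y : 0 < x -> 0 < y -> 1 <= t -> y <= t * x ->
  x^-1 ^+ 3 <=
  y^-1 ^+ 3 - 3 * (x - y) * y^-1 ^+ 4 + 6 * t ^+ 3 * (x - y) ^+ 2 * y^-1 ^+ 5.
Proof.
move=> x0 y0 t1 ytx; rewrite -lerBlDl inv3_tangent//.
have w0 : 0 <= y / x by rewrite divr_ge0 ?ltW.
have wt : y / x <= t by rewrite ler_pdivrMr.
rewrite [leRHS](_ : _ = (x - y) ^+ 2 * y^-1 ^+ 5 * (6 * t ^+ 3)); last by ring.
apply: ler_wpM2l.
  by rewrite mulr_ge0 ?sqr_ge0 ?exprn_ge0 ?invr_ge0 ?ltW.
have w3 : (y / x) ^+ 3 <= t ^+ 3 by rewrite lerXn2r ?nnegrE//; lra.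
have w2 : (y / x) ^+ 2 <= t ^+ 2 by rewrite lerXn2r ?nnegrE//; lra.
have t2 : t ^+ 2 <= t ^+ 3 by rewrite ler_weXn2l.
have t3 : t <= t ^+ 3 by rewrite ler_eXnr.
lra.
Qed.

Lemma inv6_ge_tangent t x y : 0 < x -> 0 < y -> 1 <= t -> x <= t * y ->
  y^-1 ^+ 6 - 6 * (x - y) * y^-1 ^+ 7 + 21 * t^-1 ^+ 6 * (x - y) ^+ 2 * y^-1 ^+ 8
  <= x^-1 ^+ 6.
Proof.
move=> x0 y0 t1 xty; rewrite -lerBrDl inv6_tangent//.
have t0 : 0 < t by lra.
have s0 : 0 <= t^-1 by rewrite invr_ge0 ltW.
have s1 : t^-1 <= 1 by rewrite invf_le1.
have ws : t^-1 <= y / x.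
  by rewrite ler_pdivlMr// mulrC ler_pdivrMr// mulrC.
rewrite [leLHS](_ : _ = (x - y) ^+ 2 * y^-1 ^+ 8 * (21 * t^-1 ^+ 6)); last by ring.
apply: ler_wpM2l.
  by rewrite mulr_ge0 ?sqr_ge0 ?exprn_ge0 ?invr_ge0 ?ltW.
(* All six powers of y / x are replaced by the smallest possible one, since 1 / t <= y / x and 1 / t
   <= 1. *)
have W j : (0 < j <= 6)%N -> t^-1 ^+ 6 <= (y / x) ^+ j.
  move=> /andP[j0 j6]; apply: (@le_trans _ _ (t^-1 ^+ j)).
    exact: ler_wiXn2l.
  by rewrite lerXn2r ?nnegrE// (le_trans s0).
have := W 1 isT; have := W 2 isT; have := W 3 isT; have := W 4 isT.
have := W 5 isT; have := W 6 isT; rewrite expr1; lra.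
Qed.

Lemma psd_form_ge0 (a b c m n : R) : 0 <= a + c -> b ^+ 2 <= a * c ->
  0 <= a * m ^+ 2 + 2 * b * m * n + c * n ^+ 2.
Proof.
move=> ac0 bac.
have s0 : 0 <= a * c by apply: le_trans bac; exact: sqr_ge0.
have [a0|a0|a0] := ltgtP 0 a.
- rewrite -(pmulr_rge0 _ a0).
  rewrite [leRHS](_ : _ = (a * m + b * n) ^+ 2 + (a * c - b ^+ 2) * n ^+ 2); last by ring.
  by rewrite addr_ge0 ?sqr_ge0// mulr_ge0 ?sqr_ge0 ?subr_ge0.
- by nra.
- move: bac; rewrite -a0 mul0r => b0.
  have /eqP : b ^+ 2 == 0 by rewrite eq_le b0 sqr_ge0.
  move=> /eqP; rewrite sqrf_eq0 => /eqP ->; rewrite mulr0 !mul0r !add0r.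
  by rewrite mulr_ge0 ?sqr_ge0//; lra.
Qed.

(* |m z + n|^2 / |z| for z = r (k + i h) with k^2 + h^2 = 1 *)
Definition form r k m n := r * m ^+ 2 + 2 * k * m * n + n ^+ 2 / r.

Definition strain r := (r - 1) ^+ 2 / (2 * r).

Lemma strain_ge0 r : 0 < r -> 0 <= strain r.
Proof. by move=> r0; rewrite divr_ge0 ?sqr_ge0//; lra. Qed.

Lemma form1E k m n : form 1 k m n = m ^+ 2 + n ^+ 2 + 2 * k * (m * n).
Proof. by rewrite /form; field. Qed.

Lemma form1C k m n : form 1 k m n = form 1 k n m.
Proof. by rewrite !form1E; ring. Qed.

Lemma form_gt0 r k m n : 0 < r -> k ^+ 2 < 1 -> (m != 0) || (n != 0) ->
  0 < form r k m n.
Proof.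
move=> r0 k1 mn0; rewrite -(pmulr_rgt0 _ r0).
rewrite [ltRHS](_ : _ = (n + k * (r * m)) ^+ 2 + (1 - k ^+ 2) * (r * m) ^+ 2); last first.
  by rewrite /form; field; rewrite gt_eqF.
have [m0|m0] := eqVneq m 0.
  move: mn0; rewrite m0 eqxx/= => n0; rewrite !mulr0 addr0 expr0n mulr0 addr0.
  by rewrite exprn_even_gt0.
rewrite ltr_wpDl ?sqr_ge0// mulr_gt0 ?subr_gt0// exprn_even_gt0//=.
by rewrite mulf_neq0// gt_eqF.
Qed.

(** For r = exp x, the coefficient [strain r] is cosh x - 1 and the last coefficient is sinh x.
    Exchanging m and n only reverses the sign of the sinh term. *)
Lemma form_split r k m n : 0 < r ->
  form r k m n = form 1 k m n + strain r * (m ^+ 2 + n ^+ 2)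
    + (r - r^-1) / 2 * (m ^+ 2 - n ^+ 2).
Proof. by move=> r0; rewrite /form /strain; field; rewrite gt_eqF. Qed.

Lemma skew_sq r : 0 < r -> ((r - r^-1) / 2) ^+ 2 = strain r * (2 + strain r).
Proof. by move=> r0; rewrite /strain; field; rewrite gt_eqF. Qed.

Definition distortion r k t :=
  [/\ 1 <= t & 2 * strain r * t <= (t - 1) ^+ 2 * (1 - k ^+ 2)].

(** Both forms have determinant 1 - k^2, so their relative eigenvalues are inverse to each other.
    Hence t times either form minus the other has the same determinant (t - 1)^2 - 2 t u - k^2 (t -
    1)^2, and [distortion] says that it is nonnegative. *)
Lemma distortion_form r k t m n : 0 < r -> distortion r k t ->
  form 1 k m n <= t * form r k m n /\ form r k m n <= t * form 1 k m n.
Proof.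
move=> r0 [t1 tu].
have e : r + r^-1 = 2 * strain r + 2 by rewrite /strain; field; rewrite gt_eqF.
have rr : r * r^-1 = 1 by rewrite divff// gt_eqF.
have t0 : 0 <= t by lra.
have u0 := strain_ge0 r r0.
have tu0 := mulr_ge0 t0 u0.
split; rewrite -subr_ge0.
- rewrite [leRHS](_ : _ = (t * r - 1) * m ^+ 2 + 2 * (k * (t - 1)) * m * n
    + (t * r^-1 - 1) * n ^+ 2); last by rewrite /form; field; rewrite gt_eqF.
  apply: psd_form_ge0; first by nra.
  rewrite (_ : (t * r - 1) * _ = t ^+ 2 * (r * r^-1) - t * (r + r^-1) + 1); last by ring.
  by rewrite rr e; lra.
- rewrite [leRHS](_ : _ = (t - r) * m ^+ 2 + 2 * (k * (t - 1)) * m * n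
    + (t - r^-1) * n ^+ 2); last by rewrite /form; field; rewrite gt_eqF.
  have H : (k * (t - 1)) ^+ 2 <= (t - r) * (t - r^-1).
    rewrite (_ : (t - r) * _ = t ^+ 2 - t * (r + r^-1) + r * r^-1); last by ring.
    by rewrite rr e; lra.
  apply: psd_form_ge0 => //.
  have := le_trans (sqr_ge0 _) H.
  have v0 : 0 < r^-1 by rewrite invr_gt0.
  by nra.
Qed.

End Forms.

Section Pairs.
Context {R : realFieldType}.
Implicit Types (x y t r k m n : R).

Definition pair_pow (s : nat) r k m n :=
  (form r k m n)^-1 ^+ s + (form r k n m)^-1 ^+ s.

Lemma pair_pow1 s k m n : pair_pow s 1 k m n = 2 * (form 1 k m n)^-1 ^+ s.
Proof. by rewrite /pair_pow (form1C k n m); ring. Qed.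

(** The sinh parts cancel in the sum of the deviations; in the sum of squares they survive as sinh^2
    x = u (2 + u). This is where the common factor u comes from. *)
Lemma form_devs r k m n : 0 < r ->
  let a := form r k m n - form 1 k m n in
  let b := form r k n m - form 1 k m n in
  a + b = 2 * strain r * (m ^+ 2 + n ^+ 2) /\
  a ^+ 2 + b ^+ 2 = 2 * strain r * (strain r * (m ^+ 2 + n ^+ 2) ^+ 2
                      + (2 + strain r) * (m ^+ 2 - n ^+ 2) ^+ 2).
Proof.
move=> r0 a b; rewrite /a /b !(form_split r)// (form1C k n m).
by split; first ring; move: (skew_sq r r0); set D := _ / 2 => D2; ring: D2.
Qed.

Lemma pair3_le r k t m n : 0 < r -> k ^+ 2 < 1 -> distortion r k t ->
  (m != 0) || (n != 0) ->
  pair_pow 3 r k m n - pair_pow 3 1 k m n <=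
  2 * strain r * (6 * t ^+ 3 * (strain r * (m ^+ 2 + n ^+ 2) ^+ 2
         + (2 + strain r) * (m ^+ 2 - n ^+ 2) ^+ 2) * (form 1 k m n)^-1 ^+ 5
       - 3 * (m ^+ 2 + n ^+ 2) * (form 1 k m n)^-1 ^+ 4).
Proof.
move=> r0 k1 T mn0; have nm0 : (n != 0) || (m != 0) by rewrite orbC.
have A0 := form_gt0 r k m n r0 k1 mn0; have B0 := form_gt0 r k n m r0 k1 nm0.
have P0 := form_gt0 1 k m n ltr01 k1 mn0.
have [PA _] := distortion_form r k t m n r0 T.
have [PB _] := distortion_form r k t n m r0 T; rewrite (form1C k n m) in PB.
have [t1 _] := T.
have ha := inv3_le_tangent t _ _ A0 P0 t1 PA.
have hb := inv3_le_tangent t _ _ B0 P0 t1 PB.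
have /= [e1 e2] := form_devs r k m n r0; rewrite pair_pow1 /pair_pow.
move: e1 e2 ha hb.
set P := form 1 k m n; set A := form r k m n; set B := form r k n m => e1 e2 ha hb.
rewrite [leRHS](_ : _ = - 3 * ((A - P) + (B - P)) * P^-1 ^+ 4 +
   6 * t ^+ 3 * ((A - P) ^+ 2 + (B - P) ^+ 2) * P^-1 ^+ 5); last first.
  by rewrite e1 e2; ring.
by lra.
Qed.

Lemma pair3_ge r k m n : 0 < r -> k ^+ 2 < 1 -> (m != 0) || (n != 0) ->
  - (2 * strain r * (3 * (m ^+ 2 + n ^+ 2) * (form 1 k m n)^-1 ^+ 4)) <=
  pair_pow 3 r k m n - pair_pow 3 1 k m n.
Proof.
move=> r0 k1 mn0; have nm0 : (n != 0) || (m != 0) by rewrite orbC.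
have A0 := form_gt0 r k m n r0 k1 mn0; have B0 := form_gt0 r k n m r0 k1 nm0.
have P0 := form_gt0 1 k m n ltr01 k1 mn0.
have ha := inv3_ge_tangent _ _ A0 P0; have hb := inv3_ge_tangent _ _ B0 P0.
have /= [e1 _] := form_devs r k m n r0; rewrite pair_pow1 /pair_pow.
move: e1 ha hb.
set P := form 1 k m n; set A := form r k m n; set B := form r k n m => e1 ha hb.
rewrite [leLHS](_ : _ = - 3 * ((A - P) + (B - P)) * P^-1 ^+ 4); last first.
  by rewrite e1; ring.
by lra.
Qed.

(** Of the sum of squares in [form_devs] only 4 u (m^2 - n^2)^2 is kept; the dropped part is of
    second order in u. Hence 42 = 2 * 21. Unlike in [pair3_ge], the quadratic gain cannot be given
    up, since the inequality is nearly sharp at the hexagonal point. *)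
Lemma pair6_ge r k t m n : 0 < r -> k ^+ 2 < 1 -> distortion r k t ->
  (m != 0) || (n != 0) ->
  2 * strain r * (42 * t^-1 ^+ 6 * (m ^+ 2 - n ^+ 2) ^+ 2 * (form 1 k m n)^-1 ^+ 8
       - 6 * (m ^+ 2 + n ^+ 2) * (form 1 k m n)^-1 ^+ 7) <=
  pair_pow 6 r k m n - pair_pow 6 1 k m n.
Proof.
move=> r0 k1 T mn0; have nm0 : (n != 0) || (m != 0) by rewrite orbC.
have A0 := form_gt0 r k m n r0 k1 mn0; have B0 := form_gt0 r k n m r0 k1 nm0.
have P0 := form_gt0 1 k m n ltr01 k1 mn0.
have [_ PA] := distortion_form r k t m n r0 T.
have [_ PB] := distortion_form r k t n m r0 T; rewrite (form1C k n m) in PB.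
have [t1 _] := T.
have ha := inv6_ge_tangent t _ _ A0 P0 t1 PA.
have hb := inv6_ge_tangent t _ _ B0 P0 t1 PB.
have /= [e1 e2] := form_devs r k m n r0; rewrite pair_pow1 /pair_pow.
have u0 := strain_ge0 r r0.
move: e1 e2 ha hb.
set P := form 1 k m n; set A := form r k m n; set B := form r k n m => e1 e2 ha hb.
have S : 2 * strain r * (2 * (m ^+ 2 - n ^+ 2) ^+ 2) <=
    (A - P) ^+ 2 + (B - P) ^+ 2.
  rewrite e2; apply: ler_wpM2l; first by rewrite mulr_ge0.
  rewrite -subr_ge0 (_ : _ - _ = strain r * ((m ^+ 2 + n ^+ 2) ^+ 2
    + (m ^+ 2 - n ^+ 2) ^+ 2)); last by ring.
  by rewrite mulr_ge0// addr_ge0 ?sqr_ge0.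
have c0 : 0 <= 21 * t^-1 ^+ 6 * P^-1 ^+ 8.
  rewrite mulr_ge0 ?mulr_ge0 ?exprn_ge0 ?invr_ge0 ?ltW//; lra.
have {}S := ler_wpM2l c0 S.
apply: (@le_trans _ _ (- 6 * ((A - P) + (B - P)) * P^-1 ^+ 7 +
   21 * t^-1 ^+ 6 * P^-1 ^+ 8 * ((A - P) ^+ 2 + (B - P) ^+ 2))).
  by rewrite e1; lra.
by lra.
Qed.

(* T_3 (1 + u) = 1 + u * cheb u for the Chebyshev polynomial T_3. *)
Definition cheb (u : R) := 9 + 12 * u + 4 * u ^+ 2.

Lemma cheb_strain r : 0 < r ->
  r ^+ 3 + r^-1 ^+ 3 = 2 + 2 * strain r * cheb (strain r).
Proof. by move=> r0; rewrite /cheb /strain; field; rewrite gt_eqF. Qed.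

Lemma pair_axis s r k m : 0 < r ->
  pair_pow s r k m 0 = (r ^+ s + r^-1 ^+ s) * (m^-1 ^+ 2) ^+ s.
Proof.
move=> r0; rewrite /pair_pow /form !(mulr0, mul0r, expr0n, addr0, add0r)/=.
by rewrite !invfM invrK !exprMn exprVn; ring.
Qed.

Lemma pair3_axis r k m : 0 < r ->
  pair_pow 3 r k m 0 - pair_pow 3 1 k m 0 =
  2 * strain r * (cheb (strain r) * m^-1 ^+ 6).
Proof.
by move=> r0; rewrite !pair_axis// cheb_strain// invr1 !expr1n -exprM; ring.
Qed.

Lemma pair6_axis r k m : 0 < r ->
  pair_pow 6 r k m 0 - pair_pow 6 1 k m 0 =
  2 * strain r * (cheb (strain r) * (4 + 2 * strain r * cheb (strain r)) * m^-1 ^+ 12).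
Proof.
move=> r0; rewrite !pair_axis// invr1 !expr1n -exprM.
have e : r ^+ 6 + r^-1 ^+ 6 = (r ^+ 3 + r^-1 ^+ 3) ^+ 2 - 2.
  by field; rewrite gt_eqF.
by rewrite e cheb_strain//; ring.
Qed.

Lemma pair_powC s r k m n : pair_pow s r k m n = pair_pow s r k n m.
Proof. by rewrite /pair_pow addrC. Qed.

End Pairs.

(* Off-axis points modulo sign changes and exchange of the coordinates: the classes of
   (a, b) and (a, - b), for 1 <= b <= a, have [2 * weight (a, b)] elements together. *)
Definition reps (N : nat) : seq (nat * nat) :=
  [seq (a, b) | a <- iota 1 N, b <- iota 1 a].

Definition axis_orbit (a : nat) : seq (int * int) :=
  [:: (a%:Z, 0); (- a%:Z, 0); (0, a%:Z); (0, - a%:Z)].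

Definition orbit (ab : nat * nat) : seq (int * int) :=
  let: (a, b) := (ab.1%:Z, ab.2%:Z) in
  if a == b then [:: (a, a); (- a, - a); (a, - a); (- a, a)]
  else [:: (a, b); (b, a); (- a, - b); (- b, - a);
           (a, - b); (- b, a); (- a, b); (b, - a)].

(** A decidable statement, evaluated for the two truncations in use rather than proved for every
    N. *)
Definition orbits_cover (N : nat) : bool :=
  perm_eq (punctured N)
    (flatten (map axis_orbit (iota 1 N)) ++ flatten (map orbit (reps N))).

Lemma orbits_cover4 : orbits_cover 4. Proof. by vm_compute. Qed.
Lemma orbits_cover11 : orbits_cover 11. Proof. by vm_compute. Qed.

Definition weight (ab : nat * nat) : nat := if ab.1 == ab.2 then 2 else 4.

Section Orbits.
Context {R : realType}.

(** The forms at r = 1 are invariant under exchange of the coordinates and under negation of both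
    but, for nonzero k, not under a single sign change: hence two values per representative. *)
Definition offsum N (f : R -> R -> R) : R :=
  \sum_(ab <- reps N) (weight ab)%:R *
     (f ab.1%:R ab.2%:R + f ab.1%:R (- ab.2%:R)).

Definition axsum N (j : nat) : R := \sum_(i <- iota 1 N) i%:R^-1 ^+ j.

Lemma sum_punctured N (f : R -> R -> R) : orbits_cover N ->
  (forall m n, f m n = f n m) -> (forall m n, f (- m) (- n) = f m n) ->
  \sum_(p <- punctured N) f p.1%:~R p.2%:~R =
  4 * (\sum_(i <- iota 1 N) f i%:R 0) + offsum N f.
Proof.
move=> cov fC fN; have f0 m : f (- m) 0 = f m 0 by rewrite -fN opprK oppr0.
have fN' m n : f (- m) n = f m (- n) by rewrite -fN opprK.
rewrite (perm_big _ cov)/= big_cat/=; congr (_ + _).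
  rewrite big_flatten big_map mulr_sumr; apply: eq_bigr => i _.
  rewrite /axis_orbit !(big_cons, big_nil)/= !mulrNz !(fC 0%:~R) !mulr0z f0.
  by ring.
rewrite big_flatten big_map /offsum; apply: eq_bigr => -[a b] _.
rewrite /orbit /weight/= -[a%:Z == b%:Z]/(a == b).
case: eqP => [->|_]; rewrite !(big_cons, big_nil)/= !mulrNz -!pmulrn.
  by move: (b%:R : R) => x; rewrite !fN !fN'; ring.
move: (a%:R : R) (b%:R : R) => x y.
by rewrite !fN !fN' (fC y x) (fC y (- x)) !fN'; ring.
Qed.

Lemma offsum_le N (f g : R -> R -> R) :
  (forall m n, (m != 0) || (n != 0) -> f m n <= g m n) -> offsum N f <= offsum N g.
Proof.
move=> fg; rewrite /offsum big_seq [leRHS]big_seq; apply: ler_sum => -[a b] /=.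
move=> /allpairsPdep[x [y [/[!mem_iota] xN _ [-> _]]]].
have x0 : (x%:R != 0 :> R) by rewrite pnatr_eq0; lia.
by apply: ler_wpM2l => //; rewrite lerD// fg// x0.
Qed.

Lemma offsumZ N c (f : R -> R -> R) : offsum N (fun m n => c * f m n) = c * offsum N f.
Proof. by rewrite /offsum mulr_sumr; apply: eq_bigr => ab _; ring. Qed.

Lemma offsumB N (f g : R -> R -> R) :
  offsum N (fun m n => f m n - g m n) = offsum N f - offsum N g.
Proof. by rewrite /offsum -sumrB; apply: eq_bigr => ab _; ring. Qed.

End Orbits.

(** * Summability of the powers of the forms *)

Section Deltas.
Context {R : realType}.
Implicit Types (r k t : R) (p : int * int).

Definition form_pow s r k p : R := (form r k p.1%:~R p.2%:~R)^-1 ^+ s.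

Definition form_zeta s r k : R := lattice_sum (form_pow s r k).

Lemma coord_neq0 p : p != 0 -> ((p.1%:~R : R) != 0) || ((p.2%:~R : R) != 0).
Proof.
case: p => a b; rewrite /= !intr_eq0.
have -> : ((a, b) == 0) = (a == 0) && (b == 0) by [].
by rewrite negb_and.
Qed.

Lemma supnorm_sq p :
  (supnorm p)%:R ^+ 2 = Num.max ((p.1%:~R : R) ^+ 2) (p.2%:~R ^+ 2).
Proof.
have e (i : int) : (i%:~R : R) ^+ 2 = (absz i)%:R ^+ 2.
  by rewrite natr_absz intr_norm real_normK ?num_real.
rewrite !e /supnorm; case: (leqP `|p.1| `|p.2|) => h.
  by rewrite max_r// lerXn2r ?nnegrE// ler_nat.
by rewrite max_l// lerXn2r ?nnegrE// ler_nat ltnW.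
Qed.

(** Complete the square in r times the form: in m, this leaves (1 - k^2) n^2; in n, it leaves (1 -
    k^2) r^2 m^2, where r >= 1. *)
Lemma form_supnorm r k p : 1 <= r -> k ^+ 2 < 1 ->
  (1 - k ^+ 2) / r * (supnorm p)%:R ^+ 2 <= form r k p.1%:~R p.2%:~R.
Proof.
move=> r1 k1; have r0 : 0 < r by lra.
rewrite supnorm_sq mulrAC ler_pdivrMr//.
move: (p.1%:~R : R) (p.2%:~R : R) => m n.
have e1 : form r k m n * r = (n + k * (r * m)) ^+ 2 + (1 - k ^+ 2) * m ^+ 2
   + (1 - k ^+ 2) * m ^+ 2 * (r ^+ 2 - 1).
  by rewrite /form; field; rewrite gt_eqF.
have e2 : form r k m n * r = (r * m + k * n) ^+ 2 + (1 - k ^+ 2) * n ^+ 2.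
  by rewrite /form; field; rewrite gt_eqF.
case: (leP (m ^+ 2) (n ^+ 2)) => _.
  by rewrite e2 lerDr sqr_ge0.
rewrite e1 -addrA addrCA lerDl addr_ge0 ?sqr_ge0//.
have c0 : 0 <= 1 - k ^+ 2 by rewrite subr_ge0 ltW.
have r2 : 0 <= r ^+ 2 - 1 by rewrite subr_ge0 exprn_ege1.
exact: mulr_ge0 (mulr_ge0 c0 (sqr_ge0 m)) r2.
Qed.

Lemma form_pow_ge0 s r k : 0 < r -> k ^+ 2 < 1 -> nonneg (form_pow s r k).
Proof.
move=> r0 k1 p /coord_neq0 p0; rewrite exprn_ge0// invr_ge0 ltW//.
exact: form_gt0.
Qed.

Lemma inv_pow_supnorm (c x : R) s p : p != 0 -> 0 < c ->
  c * (supnorm p)%:R ^+ 2 <= x -> x^-1 ^+ s <= c^-1 ^+ s * (supnorm p)%:R^-1 ^+ (2 * s).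
Proof.
rewrite -supnorm_gt0 => p0 c0 cx.
have N0 : 0 < (supnorm p)%:R :> R by rewrite ltr0n.
have x0 : 0 < x by apply: lt_le_trans cx; rewrite mulr_gt0// exprn_gt0.
rewrite exprM -exprMn [X in _ <= X ^+ s](_ : _ = (c * (supnorm p)%:R ^+ 2)^-1); last first.
  by rewrite invfM exprVn.
rewrite lerXn2r ?nnegrE ?invr_ge0 ?(ltW x0)//.
  by rewrite ltW// mulr_gt0 ?exprn_gt0.
by rewrite lef_pV2 ?posrE// mulr_gt0 ?exprn_gt0.
Qed.

Lemma supnorm_inv_le1 p : p != 0 ->
  (0 <= (supnorm p)%:R^-1 :> R) && ((supnorm p)%:R^-1 <= 1 :> R).
Proof.
by rewrite -supnorm_gt0 => p0; rewrite invr_ge0 ler0n invf_le1 ?ltr0n// ler1n.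
Qed.

Lemma form_pow_summed s r k : (3 <= s)%N -> 1 <= r -> k ^+ 2 < 1 ->
  exists B, summed_by (form_pow s r k) B.
Proof.
move=> s3 r1 k1; have r0 : 0 < r by lra.
have c0 : 0 < (1 - k ^+ 2) / r by rewrite divr_gt0 ?subr_gt0.
apply: (@summed_by_supnorm _ (((1 - k ^+ 2) / r)^-1 ^+ s)).
- by rewrite exprn_ge0// invr_ge0 ltW.
- exact: form_pow_ge0.
- move=> p p0; apply: le_trans (inv_pow_supnorm _ _ s _ p0 c0 (form_supnorm r k p r1 k1)) _.
  rewrite ler_wpM2l ?exprn_ge0 ?invr_ge0 ?(ltW c0)//.
  by have /andP[? ?] := supnorm_inv_le1 p p0; rewrite ler_wiXn2l//; lia.
Qed.

Definition pair_pow_at s r k p : R := pair_pow s r k p.1%:~R p.2%:~R.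

Lemma pair_pow_at_ge0 s r k : 0 < r -> k ^+ 2 < 1 -> nonneg (pair_pow_at s r k).
Proof.
move=> r0 k1 p p0; apply: addr_ge0; first exact: form_pow_ge0.
apply: (form_pow_ge0 s r k r0 k1 (p.2, p.1)).
by move: p0; rewrite -!supnorm_gt0 /supnorm/= maxnC.
Qed.

Lemma pair_pow_at_sum s r k : (3 <= s)%N -> 1 <= r -> k ^+ 2 < 1 ->
  lattice_sum (pair_pow_at s r k) = 2 * form_zeta s r k /\
  exists B, summed_by (pair_pow_at s r k) B.
Proof.
move=> s3 r1 k1; have r0 : 0 < r by lra.
have [B HB] := form_pow_summed s r k s3 r1 k1.
pose sw (p : int * int) := (p.2, p.1).
have swI : injective sw by move=> [a b] [c d] [-> ->].
have sws p : supnorm (sw p) = supnorm p by rewrite /supnorm maxnC.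
have sw0 : nonneg (form_pow s r k \o sw).
  by move=> p; rewrite -supnorm_gt0 -sws supnorm_gt0 => /(form_pow_ge0 s r k r0 k1).
have swB : summed_by (form_pow s r k \o sw) B.
  move=> N; rewrite -(big_map sw xpredT (form_pow s r k)) (perm_big (punctured N))//.
  apply: uniq_perm; rewrite ?map_inj_uniq ?punctured_uniq// => -[a b].
  rewrite -[(a, b)]/(sw (b, a)) (mem_map swI) !mem_punctured sws.
  by rewrite -!supnorm_gt0 sws.
have swS : lattice_sum (form_pow s r k \o sw) = form_zeta s r k.
  by apply: lattice_sum_bij => // -[a b]; exists (b, a).
split.
  transitivity (lattice_sum (form_pow s r k) + lattice_sum (form_pow s r k \o sw)).
    by rewrite -(lattice_sumD _ _ B B)//; exact: form_pow_ge0.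
  by rewrite swS /form_zeta; ring.
by exists (B + B) => N; rewrite big_split lerD.
Qed.

End Deltas.

(** * Explicit bounds of the increments divided by u *)

Section Increments.
Context {R : realType}.
Implicit Types (r k t : R) (p : int * int).

(** Common shape of the off-axis bounds. Numerators of degree 4 go with the power s + 2 of the form
    and those of degree 2 with s + 1, so all terms have order -2 s in the norm. *)
Definition wterm k (a b c : R) (s : nat) (m n : R) : R :=
  (a * (m ^+ 2 + n ^+ 2) ^+ 2 + b * (m ^+ 2 - n ^+ 2) ^+ 2 + c * (m ^+ 2 + n ^+ 2))
  * (form 1 k m n)^-1 ^+ s.

Definition wsum N k a b c s : R := offsum N (wterm k a b c s).

Definition tail (N : nat) : R := 2 / (N%:R * N.+1%:R) ^+ 2.

Lemma trace_le k (m n : R) : 0 <= k <= 2^-1 -> m ^+ 2 + n ^+ 2 <= 2 * form 1 k m n.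
Proof.
move=> k12; rewrite -subr_ge0 [leRHS](_ : _ =
  2 * k * (m + n) ^+ 2 + (1 - 2 * k) * (m ^+ 2 + n ^+ 2)); last by rewrite form1E; ring.
have c1 : 0 <= 2 * k by lra.
have c2 : 0 <= 1 - 2 * k by lra.
exact: addr_ge0 (mulr_ge0 c1 (sqr_ge0 _)) (mulr_ge0 c2 (addr_ge0 (sqr_ge0 m) (sqr_ge0 n))).
Qed.

(** Put p = m^2 + n^2, q = 2 m n, d = m^2 - n^2, so that p^2 = q^2 + d^2. Then (p + k q)^2 - (1 -
    k^2) d^2 = (k p + q)^2, and 1 - k^2 >= 3/4. *)
Lemma disc_le k (m n : R) : 0 <= k <= 2^-1 ->
  (m ^+ 2 - n ^+ 2) ^+ 2 <= 4 / 3 * form 1 k m n ^+ 2.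
Proof.
move=> k12; rewrite -subr_ge0 [leRHS](_ : _ =
  4 / 3 * ((k * (m ^+ 2 + n ^+ 2) + 2 * (m * n)) ^+ 2 +
   (1 / 4 - k ^+ 2) * (m ^+ 2 - n ^+ 2) ^+ 2)); last by rewrite form1E; field.
have c1 : 0 <= 1 / 4 - k ^+ 2 by nra.
apply: mulr_ge0; first by lra.
exact: addr_ge0 (sqr_ge0 _) (mulr_ge0 c1 (sqr_ge0 _)).
Qed.

Lemma form1_supnorm k p : 0 <= k <= 2^-1 ->
  3 / 4 * (supnorm p)%:R ^+ 2 <= form 1 k p.1%:~R p.2%:~R.
Proof.
move=> k12; apply: le_trans (form_supnorm 1 k p (lexx _) _); last by nra.
by rewrite ler_wpM2r ?exprn_ge0//; nra.
Qed.

Lemma form1_inv_supnorm k p s : 0 <= k <= 2^-1 -> p != 0 ->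
  (form 1 k p.1%:~R p.2%:~R)^-1 ^+ s <= (4 / 3) ^+ s * (supnorm p)%:R^-1 ^+ (2 * s).
Proof.
move=> k12 p0; rewrite [4 / 3](_ : _ = (3 / 4)^-1); last by field.
by apply: inv_pow_supnorm => //; exact: form1_supnorm.
Qed.

Lemma wterm_supnorm k a b c s p : 0 <= k <= 2^-1 -> 0 <= a -> 0 <= b -> p != 0 ->
  wterm k a b 0 s.+2 p.1%:~R p.2%:~R <=
  (4 * a + 4 / 3 * b) * ((4 / 3) ^+ s * (supnorm p)%:R^-1 ^+ (2 * s)) /\
  (0 <= c -> wterm k 0 0 c s.+1 p.1%:~R p.2%:~R <=
  2 * c * ((4 / 3) ^+ s * (supnorm p)%:R^-1 ^+ (2 * s))).
Proof.
move=> k12 a0 b0 p0; have := form1_inv_supnorm k p s k12 p0.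
have : 0 < form 1 k (p.1%:~R : R) p.2%:~R.
  by apply: form_gt0 => //; [nra|exact: coord_neq0].
rewrite /wterm.
move: (p.1%:~R : R) (p.2%:~R : R) => m n.
have := disc_le k m n k12; have := trace_le k m n k12.
set P := form 1 k m n => T D P0 I.
set y := P^-1 ^+ s in I.
have y0 : 0 <= y by rewrite exprn_ge0// invr_ge0 ltW.
have T0 : 0 <= m ^+ 2 + n ^+ 2 by rewrite addr_ge0 ?sqr_ge0.
split=> [|c0].
- have Q : (a * (m ^+ 2 + n ^+ 2) ^+ 2 + b * (m ^+ 2 - n ^+ 2) ^+ 2) * P^-1 ^+ 2
      <= 4 * a + 4 / 3 * b.
    rewrite exprVn ler_pdivrMr ?exprn_gt0//.
    have T2 : (m ^+ 2 + n ^+ 2) ^+ 2 <= 4 * P ^+ 2.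
      rewrite (_ : 4 * _ = (2 * P) ^+ 2); last by ring.
      by rewrite lerXn2r ?nnegrE// (le_trans T0).
    have := ler_wpM2l a0 T2; have := ler_wpM2l b0 D; lra.
  have -> : P^-1 ^+ s.+2 = P^-1 ^+ 2 * y by rewrite /y -exprD.
  rewrite mul0r addr0 mulrA.
  apply: le_trans (ler_wpM2r y0 Q) _; apply: ler_wpM2l I; lra.
- have Q : c * (m ^+ 2 + n ^+ 2) * P^-1 <= 2 * c.
    by rewrite ler_pdivrMr//; have := ler_wpM2l c0 T; lra.
  have -> : P^-1 ^+ s.+1 = P^-1 * y by rewrite /y -exprS.
  rewrite !mul0r !add0r mulrA.
  apply: le_trans (ler_wpM2r y0 Q) _; apply: ler_wpM2l I; lra.
Qed.

Lemma wsum_pair N k a b c a' b' c' s s' (x y : R) :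
  x * wsum N k a b c s - y * wsum N k a' b' c' s' =
  offsum N (fun m n => x * wterm k a b c s m n - y * wterm k a' b' c' s' m n).
Proof. by rewrite offsumB !offsumZ. Qed.

Lemma sum_pair_delta N s r k : orbits_cover N -> 0 < r ->
  \sum_(p <- punctured N) (pair_pow_at s r k p - pair_pow_at s 1 k p) =
  4 * (\sum_(i <- iota 1 N) (pair_pow s r k i%:R 0 - pair_pow s 1 k i%:R 0)) +
  offsum N (fun m n => pair_pow s r k m n - pair_pow s 1 k m n).
Proof.
move=> cov r0.
rewrite -(sum_punctured N (fun m n => pair_pow s r k m n - pair_pow s 1 k m n))//.
- by move=> m n; rewrite (pair_powC s r k m) (pair_powC s 1 k m).
- move=> m n; have e r' : pair_pow s r' k (- m) (- n) = pair_pow s r' k m n.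
    by rewrite /pair_pow /form !sqrrN -!mulrA !mulrNN.
  by rewrite !e.
Qed.

Lemma ksq_lt1 k : 0 <= k <= 2^-1 -> k ^+ 2 < 1.
Proof. by move=> k12; nra. Qed.

(* Bounds for the increments of [form_zeta] divided by [u]: exact axis terms, off-axis
   terms up to sup-norm [N], and the tail. *)
Definition upper3 N k u t : R :=
  4 * cheb u * axsum N 6 + 6 * t ^+ 3 * wsum N k u (2 + u) 0 5
  - 3 * wsum N k 0 0 1 4
  + 6 * t ^+ 3 * (4 * u + 4 / 3 * (2 + u)) * (64 / 27) * tail N.

Definition lower6 N k u t : R :=
  4 * (cheb u * (4 + 2 * u * cheb u)) * axsum N 12
  + 42 * t^-1 ^+ 6 * wsum N k 0 1 0 8 - 6 * wsum N k 0 0 1 7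
  - 12 * (4 / 3) ^+ 6 * N.+1%:R^-1 ^+ 6 * tail N.

Definition lower3 N k : R :=
  36 * axsum N 6 - 3 * wsum N k 0 0 1 4 - 6 * (64 / 27) * tail N.

(** [lattice_sum_compare] with the pairs at 1 as reference. In the tail the helpful term with factor
    -3 is dropped and the other one is bounded by means of (4/3)^3 = 64/27. The 2 of 2 u cancels
    against the doubling of the sum by pairing. *)
Lemma form_zeta3_le N r k t : orbits_cover N -> (0 < N)%N -> 1 <= r ->
  0 <= k <= 2^-1 -> distortion r k t ->
  form_zeta 3 r k - form_zeta 3 1 k <= strain r * upper3 N k (strain r) t.
Proof.
move=> cov N0 r1 k12 T; have k1 := ksq_lt1 k k12.
have r0 : 0 < r by lra.
have [t1 _] := T; have u0 := strain_ge0 r r0; set u := strain r in u0 *.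
have [e1 _] := pair_pow_at_sum 3 r k isT r1 k1.
have [e2 [B HB]] := pair_pow_at_sum 3 1 k isT (lexx _) k1.
pose D : R := 2 * u * (6 * t ^+ 3 * (4 * u + 4 / 3 * (2 + u)) * (64 / 27)).
have t3 : 0 <= t ^+ 3 by rewrite exprn_ge0//; lra.
have D0 : 0 <= D.
  have c0 : 0 <= 4 * u + 4 / 3 * (2 + u) by lra.
  by rewrite /D; clear D; clearbody u; move: (t ^+ 3) t3 => ? ?; rewrite !mulr_ge0.
have dom : dominated (pair_pow_at 3 r k) (pair_pow_at 3 1 k) D N.
  move=> p Np; have p0 : p != 0 by rewrite -supnorm_gt0; exact: leq_ltn_trans Np.
  have H := pair3_le r k t _ _ r0 k1 T (coord_neq0 (R:=R) p p0).
  have [W _] := wterm_supnorm k u (2 + u) 0 3 p k12 u0 ltac:(lra) p0.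
  have P0 : 0 <= (form 1 k (p.1%:~R : R) p.2%:~R)^-1 ^+ 4.
    by rewrite exprn_ge0// invr_ge0 ltW//; apply: form_gt0 => //; exact: coord_neq0.
  rewrite -lerBlDl; apply: le_trans H _; rewrite -/u.
  rewrite [leRHS](_ : _ = 2 * u * (6 * t ^+ 3 * ((4 * u + 4 / 3 * (2 + u)) *
    ((4 / 3) ^+ 3 * (supnorm p)%:R^-1 ^+ 6)))); last first.
    by rewrite /D (_ : (4 / 3 : R) ^+ 3 = 64 / 27); [ring|field].
  apply: ler_wpM2l; first by rewrite mulr_ge0.
  rewrite lerBlDr -[leLHS]addr0; apply: lerD; last first.
    apply: mulr_ge0 P0; apply: mulr_ge0 => //.
    by rewrite addr_ge0 ?sqr_ge0.
  rewrite -[leLHS]mulrA; apply: ler_wpM2l; first by rewrite mulr_ge0.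
  by rewrite /wterm mul0r addr0 in W.
have C := lattice_sum_compare N D _ _ B N0 D0 (pair_pow_at_ge0 3 r k r0 k1)
  (pair_pow_at_ge0 3 1 k ltr01 k1) HB dom.
move: C; rewrite e1 e2 sum_pair_delta//.
have -> : \sum_(i <- iota 1 N) (pair_pow 3 r k i%:R 0 - pair_pow 3 1 k i%:R 0) =
    2 * u * cheb u * axsum N 6.
  by rewrite /axsum mulr_sumr; apply: eq_bigr => i _; rewrite pair3_axis// -/u; ring.
have off : offsum N (fun m n => pair_pow 3 r k m n - pair_pow 3 1 k m n) <=
   2 * u * (6 * t ^+ 3 * wsum N k u (2 + u) 0 5 - 3 * wsum N k 0 0 1 4).
  rewrite wsum_pair -offsumZ; apply: offsum_le => m n mn0.
  apply: le_trans (pair3_le r k t m n r0 k1 T mn0) _.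
  by rewrite /wterm -/u le_eqVlt; apply/orP; left; apply/eqP; ring.
rewrite -/(tail N) /upper3 /D; lra.
Qed.

Lemma form_zeta3_ge N r k : orbits_cover N -> (0 < N)%N -> 1 <= r ->
  0 <= k <= 2^-1 -> strain r * lower3 N k <= form_zeta 3 r k - form_zeta 3 1 k.
Proof.
move=> cov N0 r1 k12; have k1 := ksq_lt1 k k12.
have r0 : 0 < r by lra.
have u0 := strain_ge0 r r0; set u := strain r in u0 *.
have [e1 [B HB]] := pair_pow_at_sum 3 r k isT r1 k1.
have [e2 _] := pair_pow_at_sum 3 1 k isT (lexx _) k1.
pose D : R := 2 * u * (6 * (64 / 27)).
have D0 : 0 <= D by rewrite /D; lra.
(* A lower bound of the increment is an upper bound of the sum at 1 by the sum at r, so the roles in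
   the comparison are exchanged. *)
have dom : dominated (pair_pow_at 3 1 k) (pair_pow_at 3 r k) D N.
  move=> p Np; have p0 : p != 0 by rewrite -supnorm_gt0; exact: leq_ltn_trans Np.
  have H := pair3_ge r k _ _ r0 k1 (coord_neq0 (R:=R) p p0).
  have [_ /(_ (ler0n _ _)) W] :=
    wterm_supnorm k 0 0 3 3 p k12 (lexx _) (lexx _) p0.
  rewrite -lerBlDl -opprB lerNl; apply: le_trans H; rewrite lerN2 -/u.
  rewrite [leRHS](_ : _ =
    2 * u * (2 * 3 * ((4 / 3) ^+ 3 * (supnorm p)%:R^-1 ^+ 6))); last first.
    by rewrite /D (_ : (4 / 3 : R) ^+ 3 = 64 / 27); [ring|field].
  apply: ler_wpM2l; first by rewrite mulr_ge0.
  by rewrite /wterm !mul0r !add0r in W.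
have C := lattice_sum_compare N D _ _ B N0 D0 (pair_pow_at_ge0 3 1 k ltr01 k1)
  (pair_pow_at_ge0 3 r k r0 k1) HB dom.
move: C; rewrite e1 e2.
rewrite (eq_bigr (fun p => - (pair_pow_at 3 r k p - pair_pow_at 3 1 k p))); last first.
  by move=> p _; rewrite opprB.
rewrite sumrN sum_pair_delta//.
have -> : \sum_(i <- iota 1 N) (pair_pow 3 r k i%:R 0 - pair_pow 3 1 k i%:R 0) =
    2 * u * cheb u * axsum N 6.
  by rewrite /axsum mulr_sumr; apply: eq_bigr => i _; rewrite pair3_axis// -/u; ring.
have off : 2 * u * (- 3 * wsum N k 0 0 1 4) <=
    offsum N (fun m n => pair_pow 3 r k m n - pair_pow 3 1 k m n).
  rewrite -!offsumZ; apply: offsum_le => m n mn0.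
  apply: le_trans (pair3_ge r k m n r0 k1 mn0).
  by rewrite /wterm -/u le_eqVlt; apply/orP; left; apply/eqP; ring.
have A : 2 * u * (9 * axsum N 6) <= 2 * u * cheb u * axsum N 6.
  rewrite -[leRHS]mulrA; apply: ler_wpM2l; first by rewrite mulr_ge0.
  apply: ler_wpM2r; first by apply: sumr_ge0 => i _; rewrite exprn_ge0.
  by rewrite /cheb; have := sqr_ge0 u; lra.
rewrite -/(tail N) /lower3 /D; lra.
Qed.

Lemma form_zeta6_ge N r k t : orbits_cover N -> (0 < N)%N -> 1 <= r ->
  0 <= k <= 2^-1 -> distortion r k t ->
  strain r * lower6 N k (strain r) t <= form_zeta 6 r k - form_zeta 6 1 k.
Proof.
move=> cov N0 r1 k12 T; have k1 := ksq_lt1 k k12.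
have r0 : 0 < r by lra.
have [t1 _] := T; have u0 := strain_ge0 r r0; set u := strain r in u0 *.
have [e1 [B HB]] := pair_pow_at_sum 6 r k isT r1 k1.
have [e2 _] := pair_pow_at_sum 6 1 k isT (lexx _) k1.
pose D : R := 2 * u * (12 * ((4 / 3) ^+ 6 * N.+1%:R^-1 ^+ 6)).
have t6 : 0 <= t^-1 ^+ 6 by rewrite exprn_ge0// invr_ge0; lra.
have D0 : 0 <= D.
  rewrite /D; apply: mulr_ge0; first by rewrite mulr_ge0.
  by rewrite !mulr_ge0 ?exprn_ge0.
have dom : dominated (pair_pow_at 6 1 k) (pair_pow_at 6 r k) D N.
  move=> p Np; have p0 : p != 0 by rewrite -supnorm_gt0; exact: leq_ltn_trans Np.
  have H := pair6_ge r k t _ _ r0 k1 T (coord_neq0 (R:=R) p p0).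
  have [_ /(_ (ler0n _ _)) W] :=
    wterm_supnorm k 0 0 6 6 p k12 (lexx _) (lexx _) p0.
  have P0 : 0 <= (form 1 k (p.1%:~R : R) p.2%:~R)^-1 ^+ 8.
    by rewrite exprn_ge0// invr_ge0 ltW//; apply: form_gt0 => //; exact: coord_neq0.
  (* The terms decay like a twelfth power; taking out the factor (N + 1)^(-6) lets the tail estimate
     for sixth powers serve again. *)
  have N1 : (supnorm p)%:R^-1 ^+ 6 <= N.+1%:R^-1 ^+ 6 :> R.
    by rewrite lerXn2r ?nnegrE ?invr_ge0// lef_pV2 ?posrE ?ltr0n// ?supnorm_gt0// ler_nat.
  have K : (4 / 3) ^+ 6 * (supnorm p)%:R^-1 ^+ 12 <=
      (4 / 3) ^+ 6 * (N.+1%:R^-1 ^+ 6 * (supnorm p)%:R^-1 ^+ 6) :> R.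
    by rewrite ler_wpM2l ?exprn_ge0// (exprD _ 6 6) ler_wpM2r ?exprn_ge0 ?invr_ge0.
  rewrite -lerBlDl -opprB lerNl; apply: le_trans H; rewrite -/u.
  rewrite [leLHS](_ : _ = 2 * u *
    - (12 * ((4 / 3) ^+ 6 * (N.+1%:R^-1 ^+ 6 * (supnorm p)%:R^-1 ^+ 6)))); last first.
    by rewrite /D; ring.
  apply: ler_wpM2l; first by rewrite mulr_ge0.
  rewrite -[leLHS]add0r; apply: lerD.
    by rewrite mulr_ge0// mulr_ge0 ?sqr_ge0// mulr_ge0.
  rewrite lerN2 (le_trans (y := 12 * ((4 / 3) ^+ 6 * (supnorm p)%:R^-1 ^+ 12)))//.
    rewrite /wterm !mul0r !add0r in W; apply: le_trans W _.
    by rewrite le_eqVlt; apply/orP; left; apply/eqP; ring.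
  by rewrite ler_wpM2l.
have C := lattice_sum_compare N D _ _ B N0 D0 (pair_pow_at_ge0 6 1 k ltr01 k1)
  (pair_pow_at_ge0 6 r k r0 k1) HB dom.
move: C; rewrite e1 e2.
rewrite (eq_bigr (fun p => - (pair_pow_at 6 r k p - pair_pow_at 6 1 k p))); last first.
  by move=> p _; rewrite opprB.
rewrite sumrN sum_pair_delta//.
have -> : \sum_(i <- iota 1 N) (pair_pow 6 r k i%:R 0 - pair_pow 6 1 k i%:R 0) =
    2 * u * (cheb u * (4 + 2 * u * cheb u)) * axsum N 12.
  by rewrite /axsum mulr_sumr; apply: eq_bigr => i _; rewrite pair6_axis// -/u; ring.
have off : 2 * u * (42 * t^-1 ^+ 6 * wsum N k 0 1 0 8 - 6 * wsum N k 0 0 1 7) <=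
    offsum N (fun m n => pair_pow 6 r k m n - pair_pow 6 1 k m n).
  rewrite wsum_pair -offsumZ; apply: offsum_le => m n mn0.
  apply: le_trans (pair6_ge r k t m n r0 k1 T mn0).
  by rewrite /wterm -/u le_eqVlt; apply/orP; left; apply/eqP; ring.
move: off; rewrite -/(tail N) /lower6 /D.
move: (t^-1 ^+ 6) (N.+1%:R^-1 ^+ 6) (tail N) (offsum N _).
move: (wsum _ _ _ _ _ _) (wsum _ _ _ _ _ _) (axsum N 12).
move: (form_zeta 6 r k) (form_zeta 6 1 k) (cheb u) => x1 x2 x3 x4 x5 x6 x7 x8 x9 x10.
lra.
Qed.

End Increments.

(** * Fixed-point interval arithmetic *)

Import BinInt.
Local Arguments Z.mul : simpl never.

Section FixedPoint.
Context {R : realType} (one : Z) (one_pos : (0 < one)%Z).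
Context (prec : Z) (shiftE : forall a, Z.shiftr a prec = (a / one)%Z).
Implicit Types (x y : R) (a b : Z).

(** Shifts and divisions of [Z] round towards minus infinity: the plain result is a lower bound, and
    one more unit gives an upper bound. *)
Definition mul_dn (a b : Z) : Z := Z.shiftr (a * b) prec.
Definition mul_up (a b : Z) : Z := (Z.shiftr (a * b) prec + 1)%Z.
Definition inv_dn (a : Z) : Z := (one * one / a)%Z.
Definition inv_up (a : Z) : Z := (one * one / a + 1)%Z.
Fixpoint pow_dn (a : Z) (n : positive) : Z :=
  match n with
  | xH => a
  | xO m => let b := pow_dn a m in mul_dn b b
  | xI m => let b := pow_dn a m in mul_dn a (mul_dn b b)
  end.
Fixpoint pow_up (a : Z) (n : positive) : Z :=
  match n with
  | xH => a
  | xO m => let b := pow_up a m in mul_up b b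
  | xI m => let b := pow_up a m in mul_up a (mul_up b b)
  end.

Definition zr a : R := (int_of_Z a)%:~R.

Lemma zrD a b : zr (a + b)%Z = zr a + zr b.
Proof. by rewrite /zr -intrD; congr intmul; exact: (raddfD int_of_Z). Qed.

Lemma zrM a b : zr (a * b)%Z = zr a * zr b.
Proof. by rewrite /zr -intrM; congr intmul; exact: (rmorphM int_of_Z). Qed.

Lemma zrN a : zr (- a)%Z = - zr a.
Proof. by rewrite /zr -intrN; congr intmul; exact: (raddfN int_of_Z). Qed.

Lemma zrB a b : zr (a - b)%Z = zr a - zr b.
Proof. by rewrite -zrN -zrD. Qed.

Lemma zr_le a b : (a <= b)%Z -> zr a <= zr b.
Proof. by move=> ab; rewrite /zr ler_int; lia. Qed.

Lemma zr_lt a b : (a < b)%Z -> zr a < zr b.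
Proof. by move=> ab; rewrite /zr ltr_int; lia. Qed.

Lemma zr_nat (n : nat) : zr (Z.of_nat n) = n%:R.
Proof.
rewrite /zr (_ : int_of_Z _ = n%:Z) ?pmulrn//; lia.
Qed.

Definition fx a : R := zr a / zr one.

Lemma zr0 : zr 0%Z = 0. Proof. by []. Qed.

Lemma zr_ge0 a : (0 <= a)%Z -> 0 <= zr a.
Proof. by move=> /zr_le; rewrite zr0. Qed.

Lemma zr_gt0 a : (0 < a)%Z -> 0 < zr a.
Proof. by move=> /zr_lt; rewrite zr0. Qed.

Lemma one_gt0 : 0 < zr one. Proof. exact: zr_gt0 one_pos. Qed.

Lemma fxD a b : fx (a + b)%Z = fx a + fx b.
Proof. by rewrite /fx zrD mulrDl. Qed.

Lemma fxB a b : fx (a - b)%Z = fx a - fx b.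
Proof. by rewrite /fx zrB mulrBl. Qed.

Lemma fxZ a b : fx (a * b)%Z = zr a * fx b.
Proof. by rewrite /fx zrM mulrA. Qed.

Lemma fx_le a b : (a <= b)%Z -> fx a <= fx b.
Proof. by move=> ab; rewrite /fx ler_pM2r ?invr_gt0 ?one_gt0// zr_le. Qed.

Lemma fx_ge0 a : (0 <= a)%Z -> 0 <= fx a.
Proof. by move=> a0; exact: divr_ge0 (zr_ge0 _ a0) (ltW one_gt0). Qed.

Lemma fx_gt0 a : (0 < a)%Z -> 0 < fx a.
Proof. by move=> a0; exact: divr_gt0 (zr_gt0 _ a0) one_gt0. Qed.

Lemma fx1 : fx one = 1.
Proof. by rewrite /fx divff// gt_eqF// one_gt0. Qed.

Lemma zr_div a b : (0 < b)%Z -> zr (a / b)%Z <= zr a / zr b <= zr (a / b + 1)%Z.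
Proof.
move=> b0; have b0' := zr_gt0 _ b0; rewrite ler_pdivlMr// ler_pdivrMr// -!zrM.
have := Z.div_mod a b; have := Z.mod_pos_bound a b b0.
by move=> ? ?; apply/andP; split; apply: zr_le; nia.
Qed.

Lemma mul_dn_le a b : fx (mul_dn a b) <= fx a * fx b.
Proof.
rewrite /mul_dn shiftE.
have /andP[h _] := zr_div (a * b) one one_pos; have o0 := one_gt0.
rewrite [leRHS](_ : _ = zr (a * b)%Z / zr one / zr one); last first.
  by rewrite /fx zrM; field; rewrite gt_eqF.
by rewrite ler_pM2r ?invr_gt0.
Qed.

Lemma mul_up_ge a b : fx a * fx b <= fx (mul_up a b).
Proof.
rewrite /mul_up shiftE.
have /andP[_ h] := zr_div (a * b) one one_pos; have o0 := one_gt0.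
rewrite [leLHS](_ : _ = zr (a * b)%Z / zr one / zr one); last first.
  by rewrite /fx zrM; field; rewrite gt_eqF.
by rewrite ler_pM2r ?invr_gt0.
Qed.

Lemma inv_bounds a : (0 < a)%Z -> fx (inv_dn a) <= (fx a)^-1 <= fx (inv_up a).
Proof.
move=> a0; have h := zr_div (one * one) a a0; have o0 := one_gt0.
have a0' := zr_gt0 _ a0.
rewrite [X in _ <= X <= _](_ : _ = zr (one * one)%Z / zr a / zr one); last first.
  by rewrite /fx zrM; field; rewrite !gt_eqF.
by rewrite !ler_pM2r ?invr_gt0.
Qed.

(* Only nonnegative quantities are enclosed, so that bounds can be multiplied. *)
Definition lbd a x := (0 <= a)%Z /\ fx a <= x.
Definition ubd a x := 0 <= x /\ x <= fx a.

Lemma lbd_fx a : (0 <= a)%Z -> lbd a (fx a). Proof. by []. Qed.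

Lemma ubd_fx a : (0 <= a)%Z -> ubd a (fx a).
Proof. by move=> a0; split => //; exact: fx_ge0. Qed.

Lemma lbd_mul a b x y : lbd a x -> lbd b y -> lbd (mul_dn a b) (x * y).
Proof.
move=> [a0 ax] [b0 bY]; split; first by rewrite /mul_dn shiftE; apply: Z.div_pos one_pos; nia.
apply: le_trans (mul_dn_le a b) _; apply: ler_pM => //; exact: fx_ge0.
Qed.

Lemma ubd_mul a b x y : ubd a x -> ubd b y -> ubd (mul_up a b) (x * y).
Proof.
move=> [x0 ax] [y0 bY]; split; first exact: mulr_ge0.
by apply: le_trans (mul_up_ge a b); apply: ler_pM.
Qed.

Lemma lbd_pow a x n : lbd a x -> lbd (pow_dn a n) (x ^+ Pos.to_nat n).
Proof.
move=> ax; elim: n => [n IH|n IH|//] /=.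
- rewrite (_ : Pos.to_nat _ = (1 + (Pos.to_nat n + Pos.to_nat n))%nat); last by lia.
  by rewrite !exprD; do 2?apply: lbd_mul.
- rewrite (_ : Pos.to_nat _ = (Pos.to_nat n + Pos.to_nat n)%nat); last by lia.
  by rewrite exprD; apply: lbd_mul.
Qed.

Lemma ubd_pow a x n : ubd a x -> ubd (pow_up a n) (x ^+ Pos.to_nat n).
Proof.
move=> ax; elim: n => [n IH|n IH|//] /=.
- rewrite (_ : Pos.to_nat _ = (1 + (Pos.to_nat n + Pos.to_nat n))%nat); last by lia.
  by rewrite !exprD; do 2?apply: ubd_mul.
- rewrite (_ : Pos.to_nat _ = (Pos.to_nat n + Pos.to_nat n)%nat); last by lia.
  by rewrite exprD; apply: ubd_mul.
Qed.

Lemma lbd_inv a x : 0 < x -> x <= fx a -> lbd (inv_dn a) x^-1.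
Proof.
move=> x0 xa; have a0 : (0 < a)%Z.
  have := lt_le_trans x0 xa; case: (Z.lt_ge_cases 0 a) => // /zr_le; rewrite zr0 => a0.
  by rewrite /fx pmulr_lgt0 ?invr_gt0 ?one_gt0// ltNge a0.
split; first by apply: Z.div_pos a0; have := one_pos; nia.
have /andP[h _] := inv_bounds a a0; apply: le_trans h _.
by rewrite lef_pV2 ?posrE ?fx_gt0.
Qed.

Lemma ubd_inv a x : (0 < a)%Z -> fx a <= x -> ubd (inv_up a) x^-1.
Proof.
move=> a0 ax; have fa := fx_gt0 _ a0.
split; first by rewrite invr_ge0; apply: le_trans ax; exact: ltW.
have /andP[_ h] := inv_bounds a a0; apply: le_trans h.
by rewrite lef_pV2 ?posrE// (lt_le_trans fa).
Qed.

Lemma lbd_add a b x y : lbd a x -> lbd b y -> lbd (a + b)%Z (x + y).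
Proof. by move=> [? ?] [? ?]; split; [lia|rewrite fxD lerD]. Qed.

Lemma ubd_add a b x y : ubd a x -> ubd b y -> ubd (a + b)%Z (x + y).
Proof. by move=> [? ?] [? ?]; split; [exact: addr_ge0|rewrite fxD lerD]. Qed.

Lemma lbd_scale c a x : (0 <= c)%Z -> lbd a x -> lbd (c * a)%Z (zr c * x).
Proof.
move=> c0 [a0 ax]; split; first by nia.
by rewrite fxZ ler_wpM2l// zr_ge0.
Qed.

Lemma ubd_scale c a x : (0 <= c)%Z -> ubd a x -> ubd (c * a)%Z (zr c * x).
Proof.
move=> c0 [x0 ax]; have c0' := zr_ge0 _ c0; split; first exact: mulr_ge0.
by rewrite fxZ ler_wpM2l.
Qed.


Lemma zr2 : zr 2 = 2 :> R. Proof. exact: (zr_nat 2). Qed.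

Definition weight_poly (al be ga p d : Z) : Z :=
  (p * p * al + d * d * be + p * ga)%Z.

(** The form p + 2 a b k at (a, b) increases with k, and p - 2 a b k at (a, -b) decreases. Since
    inverses are summed, the upper bound takes the first at [k1] and the second at [k2]; [term_dn]
    takes the opposite ends. *)
Definition term_up k1 k2 (s : positive) al be ga (a b : Z) : Z :=
  let p := (a * a + b * b)%Z in
  let W := weight_poly al be ga p (a * a - b * b)%Z in
  (mul_up W (pow_up (inv_up (p * one + 2 * (a * b) * k1)) s)
   + mul_up W (pow_up (inv_up (p * one - 2 * (a * b) * k2)) s))%Z.

Definition term_dn k1 k2 (s : positive) al be ga (a b : Z) : Z :=
  let p := (a * a + b * b)%Z in
  let W := weight_poly al be ga p (a * a - b * b)%Z in
  (mul_dn W (pow_dn (inv_dn (p * one + 2 * (a * b) * k2)) s)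
   + mul_dn W (pow_dn (inv_dn (p * one - 2 * (a * b) * k1)) s))%Z.

Definition wsum_by (term : Z -> Z -> Z) (N : nat) : Z :=
  foldr (fun ab z => (Z.of_nat (weight ab) * term (Z.of_nat ab.1) (Z.of_nat ab.2) + z)%Z)
    0%Z (reps N).

Definition wsum_up k1 k2 s al be ga := wsum_by (term_up k1 k2 s al be ga).
Definition wsum_dn k1 k2 s al be ga := wsum_by (term_dn k1 k2 s al be ga).

Definition axsum_up N (j : positive) : Z :=
  foldr (fun i z => (pow_up (inv_up (Z.of_nat i * one)) j + z)%Z) 0%Z (iota 1 N).
Definition axsum_dn N (j : positive) : Z :=
  foldr (fun i z => (pow_dn (inv_dn (Z.of_nat i * one)) j + z)%Z) 0%Z (iota 1 N).

Lemma fx_form (p e c : Z) :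
  fx (p * one + 2 * e * c)%Z = zr p + 2 * (zr e * fx c) /\
  fx (p * one - 2 * e * c)%Z = zr p - 2 * (zr e * fx c).
Proof. by rewrite fxD fxB !fxZ fx1 mulr1 zrM zr2 mulrA. Qed.

Section Box.
Context (k1 k2 : Z) (k : R).
Hypothesis k10 : (0 <= k1)%Z.
Hypothesis k2h : (2 * k2 <= one)%Z.
Hypothesis kb : fx k1 <= k <= fx k2.

Lemma box_range : 0 <= k <= 2^-1.
Proof.
have /andP[h1 h2] := kb; rewrite (le_trans (fx_ge0 _ k10) h1)/=.
apply: le_trans h2 _; have := fx_le _ _ k2h; rewrite fx1 fxZ zr2; lra.
Qed.

Lemma rep_bounds (ab : nat * nat) N : ab \in reps N ->
  (0 < Z.of_nat ab.2)%Z /\ (Z.of_nat ab.2 <= Z.of_nat ab.1)%Z.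
Proof.
by move=> /allpairsPdep[x [y [/[!mem_iota] xN yN ->]]] /=; lia.
Qed.

Lemma form_zr (a b : Z) : form 1 k (zr a) (zr b) = zr (a * a + b * b)%Z + 2 * (zr (a * b)%Z * k)
  /\ form 1 k (zr a) (- zr b) = zr (a * a + b * b)%Z - 2 * (zr (a * b)%Z * k).
Proof. by rewrite !form1E zrD !zrM; split; ring. Qed.

(** Positivity at (a, -b) rests on 2 a b <= a^2 + b^2 and k <= 1/2: then p - 2 a b k >= a b > 0. *)
Lemma form_bounds (a b : Z) : (0 < b)%Z -> (b <= a)%Z ->
  [/\ (0 < (a * a + b * b) * one + 2 * (a * b) * k1)%Z,
      (0 < (a * a + b * b) * one - 2 * (a * b) * k2)%Z,
      fx ((a * a + b * b) * one + 2 * (a * b) * k1)%Z <= form 1 k (zr a) (zr b)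
      <= fx ((a * a + b * b) * one + 2 * (a * b) * k2)%Z &
      fx ((a * a + b * b) * one - 2 * (a * b) * k2)%Z <= form 1 k (zr a) (- zr b)
      <= fx ((a * a + b * b) * one - 2 * (a * b) * k1)%Z].
Proof.
move=> b0 ba; have /andP[h1 h2] := kb.
have ab0 : (0 < a * b)%Z by nia.
have ab0' := ltW (zr_gt0 _ ab0).
have [e1 e2] := form_zr a b.
have pab : (2 * (a * b) <= a * a + b * b)%Z by nia.
have q1 : (0 < a * b * one)%Z by apply: Z.mul_pos_pos.
have q2 : (2 * (a * b) * one <= (a * a + b * b) * one)%Z.
  by apply: Z.mul_le_mono_nonneg_r => //; lia.
have q3 : (a * b * (2 * k2) <= a * b * one)%Z by apply: Z.mul_le_mono_nonneg_l; lia.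
have q4 : (0 <= a * b * k1)%Z by apply: Z.mul_nonneg_nonneg; lia.
have H1 := ler_wpM2l ab0' h1; have H2 := ler_wpM2l ab0' h2.
split; [lia|lia| |].
  by have [-> _] := fx_form (a * a + b * b) (a * b) k1;
     have [-> _] := fx_form (a * a + b * b) (a * b) k2; rewrite e1; lra.
by have [_ ->] := fx_form (a * a + b * b) (a * b) k1;
   have [_ ->] := fx_form (a * a + b * b) (a * b) k2; rewrite e2; lra.
Qed.

Context (al be ga : Z) (x y z : R) (s : positive).

Lemma weight_ubd (p d : Z) : (0 <= p)%Z -> ubd al x -> ubd be y -> ubd ga z ->
  ubd (weight_poly al be ga p d) (x * zr p ^+ 2 + y * zr d ^+ 2 + z * zr p).
Proof.
move=> p0 ax bey gaz.
rewrite (_ : _ + _ = zr (p * p)%Z * x + zr (d * d)%Z * y + zr p * z); last first.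
  by rewrite !zrM; ring.
by do 2?apply: ubd_add; apply: ubd_scale => //; nia.
Qed.

Lemma weight_lbd (p d : Z) : (0 <= p)%Z -> lbd al x -> lbd be y -> lbd ga z ->
  lbd (weight_poly al be ga p d) (x * zr p ^+ 2 + y * zr d ^+ 2 + z * zr p).
Proof.
move=> p0 ax bey gaz.
rewrite (_ : _ + _ = zr (p * p)%Z * x + zr (d * d)%Z * y + zr p * z); last first.
  by rewrite !zrM; ring.
by do 2?apply: lbd_add; apply: lbd_scale => //; nia.
Qed.

Lemma wterm_zr (a b : Z) :
  let W := x * zr (a * a + b * b)%Z ^+ 2 + y * zr (a * a - b * b)%Z ^+ 2
           + z * zr (a * a + b * b)%Z in
  wterm k x y z (Pos.to_nat s) (zr a) (zr b) =
    W * (form 1 k (zr a) (zr b))^-1 ^+ Pos.to_nat s /\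
  wterm k x y z (Pos.to_nat s) (zr a) (- zr b) =
    W * (form 1 k (zr a) (- zr b))^-1 ^+ Pos.to_nat s.
Proof. by rewrite /wterm !zrB !zrD !zrM sqrrN !expr2. Qed.

Lemma wsum_up_ok N : ubd al x -> ubd be y -> ubd ga z ->
  ubd (wsum_up k1 k2 s al be ga N) (wsum N k x y z (Pos.to_nat s)).
Proof.
move=> ax bey gaz; rewrite /wsum /offsum /wsum_up /wsum_by.
have : {subset reps N <= reps N} by [].
elim: {-2}(reps N) => [|ab l IH] lN; first by rewrite big_nil; split; rewrite /= ?fx_ge0.
rewrite big_cons /=; apply: ubd_add; last by apply: IH => c cl; apply: lN; rewrite inE cl orbT.
have [b0 ba] := rep_bounds ab N (lN ab (mem_head _ _)).
rewrite -!zr_nat; apply: ubd_scale; first by lia.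
move: (Z.of_nat ab.1) (Z.of_nat ab.2) b0 ba => a b b0 ba.
have /= [-> ->] := wterm_zr a b.
have [c1 c2 /andP[f1 f2] /andP[g1 g2]] := form_bounds a b b0 ba.
have W := weight_ubd (a * a + b * b) (a * a - b * b) ltac:(nia) ax bey gaz.
by apply: ubd_add; apply: ubd_mul => //; apply: ubd_pow; apply: ubd_inv.
Qed.

Lemma wsum_dn_ok N : lbd al x -> lbd be y -> lbd ga z ->
  lbd (wsum_dn k1 k2 s al be ga N) (wsum N k x y z (Pos.to_nat s)).
Proof.
move=> ax bey gaz; rewrite /wsum /offsum /wsum_dn /wsum_by.
have : {subset reps N <= reps N} by [].
elim: {-2}(reps N) => [|ab l IH] lN.
  by rewrite big_nil; split; rewrite /= /fx ?zr0 ?mul0r.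
rewrite big_cons /=; apply: lbd_add; last by apply: IH => c cl; apply: lN; rewrite inE cl orbT.
have [b0 ba] := rep_bounds ab N (lN ab (mem_head _ _)).
rewrite -!zr_nat; apply: lbd_scale; first by lia.
move: (Z.of_nat ab.1) (Z.of_nat ab.2) b0 ba => a b b0 ba.
have /= [-> ->] := wterm_zr a b.
have [c1 c2 /andP[f1 f2] /andP[g1 g2]] := form_bounds a b b0 ba.
have W := weight_lbd (a * a + b * b) (a * a - b * b) ltac:(nia) ax bey gaz.
have A1 := lt_le_trans (fx_gt0 _ c1) f1; have A2 := lt_le_trans (fx_gt0 _ c2) g1.
by apply: lbd_add; apply: lbd_mul => //; apply: lbd_pow; apply: lbd_inv.
Qed.

End Box.

Lemma axsum_up_ok N j : ubd (axsum_up N j) (axsum N (Pos.to_nat j)).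
Proof.
rewrite /axsum /axsum_up; have : {subset iota 1 N <= iota 1 N} by [].
elim: {-2}(iota 1 N) => [|i l IH] lN; first by rewrite big_nil; split; rewrite /= ?fx_ge0.
rewrite big_cons /=; apply: ubd_add; last by apply: IH => c cl; apply: lN; rewrite inE cl orbT.
have := lN i (mem_head _ _); rewrite mem_iota => iN.
by apply: ubd_pow; apply: ubd_inv; [nia|rewrite fxZ fx1 mulr1 zr_nat].
Qed.

Lemma axsum_dn_ok N j : lbd (axsum_dn N j) (axsum N (Pos.to_nat j)).
Proof.
rewrite /axsum /axsum_dn; have : {subset iota 1 N <= iota 1 N} by [].
elim: {-2}(iota 1 N) => [|i l IH] lN.
  by rewrite big_nil; split; rewrite /= /fx ?zr0 ?mul0r.
rewrite big_cons /=; apply: lbd_add; last by apply: IH => c cl; apply: lN; rewrite inE cl orbT.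
have := lN i (mem_head _ _); rewrite mem_iota => iN.
apply: lbd_pow; apply: lbd_inv; last by rewrite fxZ fx1 mulr1 zr_nat.
by rewrite ltr0n; lia.
Qed.


(** * Enclosures of the increment bounds and the test of a box *)

Definition cheb_up u : Z := (9 * one + 12 * u + 4 * mul_up u u)%Z.
Definition cheb_dn u : Z := (9 * one + 12 * u + 4 * mul_dn u u)%Z.

(** Encloses 64/81 times [tail N]. In [upper3] the tail factor 4 u + 4/3 (2 + u) equals (16 u + 8) /
    3, and its denominator 3 is merged with 64/27. *)
Definition tail_up (N : nat) : Z :=
  let n := (Z.of_nat N * (Z.of_nat N + 1))%Z in (128 * inv_up (81 * (n * n) * one))%Z.

Definition upper3_up N k1 k2 u2 t : Z :=
  (4 * mul_up (cheb_up u2) (axsum_up N 6)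
   + 6 * mul_up (pow_up t 3) (wsum_up k1 k2 5 u2 (2 * one + u2) 0 N)
   + 6 * mul_up (pow_up t 3) (mul_up (16 * u2 + 8 * one) (tail_up N))
   - 3 * wsum_dn k1 k2 4 0 0 one N)%Z.

(** The truncation is always 4. The last term 1/40000 replaces the tail of [lower6], which is about
    2.2e-5. *)
Definition lower6_dn k1 k2 u1 t : Z :=
  (4 * mul_dn (mul_dn (cheb_dn u1) (4 * one + 2 * mul_dn u1 (cheb_dn u1))) (axsum_dn 4 12)
   + 42 * mul_dn (pow_dn (inv_dn t) 6) (wsum_dn k1 k2 8 0 one 0 4)
   - 6 * wsum_up k1 k2 7 0 0 one 4 - inv_up (200 * 200 * one))%Z.

(* The least [t >= 1] with [2 u t <= (t - 1) ^ 2 (1 - k ^ 2)], up to rounding. *)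
Definition distortion_guess k2 u2 : Z :=
  let a := (2 * u2 * one / (one - mul_up k2 k2) + 1)%Z in
  (one + ((a + Z.sqrt (a * a + 4 * a * one)) / 2 + 2))%Z.

(** Nothing is assumed of [distortion_guess]: the first two tests check its value at the worst
    corner ([k2], [u2]). Here [h] is a lower bound of 1 - k^2, and the lone factor [one] in the last
    test matches the scale carried by [pow_dn h 3]. *)
Definition box_ok N k1 k2 u1 u2 : bool :=
  let t := distortion_guess k2 u2 in
  let U := upper3_up N k1 k2 u2 t in
  let L := lower6_dn k1 k2 u1 t in
  let h := (one - mul_up k2 k2)%Z in
  [&& (one <=? t)%Z,
      (2 * u2 * t * (one * one) <=? (t - one) * (t - one) * (one * one - k2 * k2))%Z,
      (0 <=? h)%Z, (0 <=? L)%Z &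
      (306 * 306 * (U * U * one) <=? 100 * 100 * (pow_dn h 3 * L * L))%Z].

(* With k ^ 2 + h ^ 2 = 1 the last inequality is (3.06 U) ^ 2 <= (h ^ 3 L) ^ 2. *)
Definition certified N k u := exists t U L : R,
  [/\ 1 <= t, 2 * u * t <= (t - 1) ^+ 2 * (1 - k ^+ 2), upper3 N k u t <= U,
      0 <= L <= lower6 4 k u t &
      (306 / 100) ^+ 2 * U ^+ 2 <= (1 - k ^+ 2) ^+ 3 * L ^+ 2].

Lemma zr_pos (p : positive) : zr (Zpos p) = (Pos.to_nat p)%:R :> R.
Proof. by rewrite /zr /= pmulrn. Qed.

Lemma ubd_cheb u x : (0 <= u)%Z -> ubd u x -> ubd (cheb_up u) (cheb x).
Proof.
move=> u0 ux; rewrite /cheb expr2 -[9]mulr1 -(zr_pos 9) -(zr_pos 12) -(zr_pos 4) -fx1.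
do 2?apply: ubd_add; apply: ubd_scale => //; [apply: ubd_fx; lia|exact: ubd_mul].
Qed.

Lemma lbd_cheb u x : lbd u x -> lbd (cheb_dn u) (cheb x).
Proof.
move=> ux; rewrite /cheb expr2 -[9]mulr1 -(zr_pos 9) -(zr_pos 12) -(zr_pos 4) -fx1.
do 2?apply: lbd_add; apply: lbd_scale => //; [apply: lbd_fx; lia|exact: lbd_mul].
Qed.

Lemma ubd_tail (N : nat) : (0 < N)%nat -> ubd (tail_up N) (64 / 81 * tail N).
Proof.
move=> N0; have n0 : (0 < Z.of_nat N)%Z by lia.
have e : 64 / 81 * tail N = zr 128 * (zr (81 * (Z.of_nat N * (Z.of_nat N + 1)
    * (Z.of_nat N * (Z.of_nat N + 1)))))^-1 :> R.
  have -> : (Z.of_nat N + 1)%Z = Z.of_nat N.+1 by lia.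
  have e1 : zr 128 = 128 :> R := zr_pos 128.
  have e2 : zr 81 = 81 :> R := zr_pos 81.
  have Np : 0 < N%:R :> R by rewrite ltr0n.
  rewrite !zrM !zr_nat e1 e2 /tail -natr1; field.
  by rewrite !gt_eqF//; lra.
rewrite e; apply: ubd_scale => //; apply: ubd_inv; first by nia.
by rewrite fxZ fx1 mulr1.
Qed.

Lemma upper3_up_ok (N : nat) k1 k2 u2 t k u v :
  (0 < N)%nat -> (0 <= k1)%Z -> (2 * k2 <= one)%Z ->
  fx k1 <= k <= fx k2 -> 0 <= u -> u <= fx u2 -> (0 <= u2)%Z -> ubd t v ->
  upper3 N k u v <= fx (upper3_up N k1 k2 u2 t).
Proof.
move=> N0 k10 k2h kb u0 uu u20 tv.
have uu2 : ubd u2 u by [].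
have u2p : ubd (2 * one + u2) (2 + u).
  apply: ubd_add => //; rewrite -[2]mulr1 -(zr_pos 2) -fx1.
  by apply: ubd_scale => //; apply: ubd_fx; lia.
have z0 : ubd 0 0 by split; rewrite // /fx zr0 mul0r.
have z0' : lbd 0 0 by split; rewrite // /fx zr0 mul0r.
have o1 : lbd one 1 by split; [lia|rewrite fx1].
have t3 := ubd_pow _ _ 3 tv.
have [_ A] : ubd (4 * mul_up (cheb_up u2) (axsum_up N 6)) (4 * (cheb u * axsum N 6)).
  rewrite -(zr_pos 4); apply: ubd_scale => //; apply: ubd_mul; first exact: ubd_cheb.
  exact: axsum_up_ok.
have [_ B] : ubd (6 * mul_up (pow_up t 3) (wsum_up k1 k2 5 u2 (2 * one + u2) 0 N))
    (6 * (v ^+ 3 * wsum N k u (2 + u) 0 5)).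
  rewrite -(zr_pos 6); apply: ubd_scale => //; apply: ubd_mul => //.
  exact: wsum_up_ok.
have [_ C] : ubd (6 * mul_up (pow_up t 3) (mul_up (16 * u2 + 8 * one) (tail_up N)))
    (6 * (v ^+ 3 * ((16 * u + 8) * (64 / 81 * tail N)))).
  rewrite -(zr_pos 6) -(zr_pos 16) [8](_ : _ = zr 8 * fx one); last first.
    by rewrite fx1 mulr1 zr_pos.
  apply: ubd_scale => //; apply: ubd_mul => //; apply: ubd_mul; last exact: ubd_tail.
  by apply: ubd_add; apply: ubd_scale => //; apply: ubd_fx; lia.
have [_ D] := wsum_dn_ok k1 k2 k k10 k2h kb 0 0 one 0 0 1 4 N z0' z0' o1.
have d1 : fx (3 * wsum_dn k1 k2 4 0 0 one N) = 3 * fx (wsum_dn k1 k2 4 0 0 one N).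
  by rewrite fxZ (zr_pos 3).
rewrite /upper3_up fxB !fxD d1 /upper3; lra.
Qed.

Lemma lower6_dn_ok k1 k2 u1 t k u v : (0 <= k1)%Z -> (2 * k2 <= one)%Z ->
  fx k1 <= k <= fx k2 -> lbd u1 u -> 0 < v -> v <= fx t ->
  fx (lower6_dn k1 k2 u1 t) <= lower6 4 k u v.
Proof.
move=> k10 k2h kb uu v0 vt.
have z0 : ubd 0 0 by split; rewrite // /fx zr0 mul0r.
have z0' : lbd 0 0 by split; rewrite // /fx zr0 mul0r.
have o1 : lbd one 1 by split; [lia|rewrite fx1].
have o1' : ubd one 1 by split; rewrite ?fx1.
have c := lbd_cheb _ _ uu.
have [_ A] : lbd (4 * mul_dn (mul_dn (cheb_dn u1)
      (4 * one + 2 * mul_dn u1 (cheb_dn u1))) (axsum_dn 4 12))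
   (4 * (cheb u * (4 * 1 + 2 * (u * cheb u)) * axsum 4 12)).
  rewrite -(zr_pos 4) -(zr_pos 2); apply: lbd_scale => //.
  apply: lbd_mul; last exact: axsum_dn_ok.
  apply: lbd_mul => //; apply: lbd_add; apply: lbd_scale => //; exact: lbd_mul.
have [_ B] : lbd (42 * mul_dn (pow_dn (inv_dn t) 6) (wsum_dn k1 k2 8 0 one 0 4))
   (42 * (v^-1 ^+ 6 * wsum 4 k 0 1 0 8)).
  rewrite -(zr_pos 42); apply: lbd_scale => //; apply: lbd_mul; last exact: wsum_dn_ok.
  by apply: lbd_pow; apply: lbd_inv.
have [_ C] := wsum_up_ok k1 k2 k k10 k2h kb 0 0 one 0 0 1 7 4 z0 z0 o1'.
have [_ D] : ubd (inv_up (200 * 200 * one)) (200 * 200)^-1.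
  by apply: ubd_inv; [lia|rewrite fxZ fx1 mulr1 zrM !zr_pos].
have d1 : fx (6 * wsum_up k1 k2 7 0 0 one 4) = 6 * fx (wsum_up k1 k2 7 0 0 one 4).
  by rewrite fxZ (zr_pos 6).
have d2 : 12 * (4 / 3) ^+ 6 * 5^-1 ^+ 6 * tail 4 <= (200 * 200)^-1 :> R.
  rewrite /tail; lra.
rewrite /lower6_dn !fxB fxD d1 /lower6; lra.
Qed.

Lemma box_ok_sound (N : nat) k1 k2 u1 u2 k u :
  (0 < N)%nat -> (0 <= k1)%Z -> (2 * k2 <= one)%Z ->
  fx k1 <= k <= fx k2 -> (0 <= u1)%Z -> fx u1 <= u <= fx u2 ->
  box_ok N k1 k2 u1 u2 -> certified N k u.
Proof.
move=> N0 k10 k2h kb u10 /andP[ua ub].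
rewrite /box_ok; set t := distortion_guess k2 u2; set U := upper3_up _ _ _ _ _.
set L := lower6_dn _ _ _ _; set h := (one - _)%Z.
move=> /and5P[/Z.leb_le t1 /Z.leb_le td /Z.leb_le h0 /Z.leb_le L0 /Z.leb_le UL].
have u0 : 0 <= u by apply: le_trans ua; exact: fx_ge0.
have u20 : (0 <= u2)%Z.
  case: (Z.le_gt_cases 0 u2) => // u2n; have : fx u2 < 0 :> R.
    by rewrite /fx pmulr_llt0 ?invr_gt0 ?one_gt0// -zr0 zr_lt.
  by move/(le_lt_trans ub); rewrite ltNge u0.
have o0 := one_gt0.
have [k0 kh] : 0 <= k /\ k <= 2^-1 by apply/andP; exact: box_range kb.
have ft1 : 1 <= fx t by rewrite -fx1; exact: fx_le.
exists (fx t), (fx U), (fx L); split.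
- exact: ft1.
- have := zr_le _ _ td.
  rewrite !(zrM, zrB) zr2 => H.
  have {}H : 2 * fx u2 * fx t <= (fx t - 1) ^+ 2 * (1 - fx k2 ^+ 2).
    rewrite -(ler_pM2r (exprn_gt0 4 o0)).
    rewrite [leLHS](_ : _ = 2 * zr u2 * zr t * (zr one * zr one)); last first.
      by rewrite /fx; field; rewrite gt_eqF.
    rewrite [leRHS](_ : _ = (zr t - zr one) * (zr t - zr one) *
      (zr one * zr one - zr k2 * zr k2))//.
    by rewrite /fx; field; rewrite gt_eqF.
  have kk : k ^+ 2 <= fx k2 ^+ 2.
    by have /andP[_ ?] := kb; rewrite lerXn2r ?nnegrE// (le_trans k0).
  have A : 2 * u * fx t <= 2 * fx u2 * fx t by rewrite ler_pM2r; lra.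
  have B : (fx t - 1) ^+ 2 * (1 - fx k2 ^+ 2) <= (fx t - 1) ^+ 2 * (1 - k ^+ 2).
    by rewrite ler_wpM2l ?sqr_ge0//; lra.
  by lra.
- apply: upper3_up_ok => //; apply: ubd_fx; lia.
- rewrite fx_ge0//; apply: lower6_dn_ok => //; lra.
- have := zr_le _ _ UL; rewrite !zrM => H.
  have hk : lbd (pow_dn h 3) ((1 - k ^+ 2) ^+ 3).
    apply: lbd_pow; split => //; rewrite fxB fx1 lerB//.
    apply: le_trans (mul_up_ge _ _); rewrite expr2.
    by have /andP[_ ?] := kb; apply: ler_pM.
  have [_ hk'] := hk.
  apply: le_trans (ler_wpM2r (sqr_ge0 (fx L)) hk').
  have e306 : zr 306 = 306 :> R := zr_pos 306.
  have e100 : zr 100 = 100 :> R := zr_pos 100.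
  rewrite e306 e100 in H.
  have c0 : 0 < 100 * 100 * zr one ^+ 3 :> R by rewrite mulr_gt0 ?exprn_gt0// mulr_gt0.
  rewrite -(ler_pM2r c0).
  rewrite [leLHS](_ : _ = 306 * 306 * (zr U * zr U * zr one)); last first.
    by rewrite /fx; field; rewrite gt_eqF.
  rewrite [leRHS](_ : _ = 100 * 100 * (zr (pow_dn h 3) * zr L * zr L))//.
  by rewrite /fx; field; rewrite gt_eqF.
Qed.

End FixedPoint.

(* The admissible pairs satisfy 4 k (1 + u - k) <= 1, that is,
   (1 - 2 k r) (1 - 2 k / r) >= 0.  Boxes violating this are discarded, and [u3] is the
   largest admissible [u] at [k1]. *)
Fixpoint bisect (one prec : Z) (fuel : nat) (k1 k2 u1 u2 : Z) : bool :=
  if fuel is fuel'.+1 then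
    if (one * one <? 4 * k1 * (one + u1 - k1))%Z then true else
    let u3 := if (0 <? k1)%Z
      then Z.min u2 ((one - 2 * k1) * (one - 2 * k1) / (4 * k1) + 1)%Z else u2 in
    if box_ok one prec (if (49 * one <=? 100 * k1)%Z then 11 else 4) k1 k2 u1 u3 then true
    else if (3 * (k2 - k1) <? 10 * (u3 - u1))%Z
    then let c := ((u1 + u3) / 2)%Z in
      if bisect one prec fuel' k1 k2 u1 c then bisect one prec fuel' k1 k2 c u3 else false
    else let c := ((k1 + k2) / 2)%Z in
      if bisect one prec fuel' k1 c u1 u3 then bisect one prec fuel' c k2 u1 u3 else false
  else false.

(** * Soundness of the bisection *)

Section Bisection.
Context {R : realType} (one : Z) (one_pos : (0 < one)%Z).
Context (prec : Z) (shiftE : forall a, Z.shiftr a prec = (a / one)%Z).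

Local Notation fx := (@fx R one).

(** The constraint solved for u is u <= (1 - 2 k)^2 / (4 k), which decreases in k on (0, 1/2]; so
    the left end [k1] gives the bound for the whole box. *)
Lemma strain_bound (k1 : Z) (k u : R) : (0 < k1)%Z -> fx k1 <= k -> k <= 2^-1 -> 0 <= u ->
  4 * k * (1 + u - k) <= 1 ->
  u <= fx ((one - 2 * k1) * (one - 2 * k1) / (4 * k1) + 1)%Z.
Proof.
move=> k10 k1k kh u0 H; have a0 : 0 < fx k1 by exact: fx_gt0.
have o0 := @one_gt0 R one one_pos; have z0 := zr_gt0 k1 k10 (R := R).
have k40 : (0 < 4 * k1)%Z by lia.
have /andP[_ D] := zr_div ((one - 2 * k1) * (one - 2 * k1)) (4 * k1) k40 (R := R).
have e4 : zr 4 = 4 :> R := zr_pos 4.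
apply: (@le_trans _ _ ((1 - 2 * fx k1) ^+ 2 / (4 * fx k1))).
  rewrite ler_pdivlMr; last by lra.
  have : (k - fx k1) * (1 + u - k - fx k1) >= 0 by apply: mulr_ge0; lra.
  by lra.
rewrite [leLHS](_ : _ =
  zr ((one - 2 * k1) * (one - 2 * k1))%Z / zr (4 * k1)%Z / zr one); last first.
  by rewrite !zrM !zrB zrM zr2 e4 /fx; field; rewrite !gt_eqF.
by rewrite /fx ler_pM2r ?invr_gt0.
Qed.

Lemma fx_mid (a b : Z) (x : R) : fx a <= x <= fx b ->
  (fx a <= x <= fx ((a + b) / 2)%Z) || (fx ((a + b) / 2)%Z <= x <= fx b).
Proof. by move=> /andP[-> ->] /=; rewrite andbT; apply: le_total. Qed.

(** The rules choosing N and the side to cut affect only the running time and success: each box is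
    empty of admissible points, certified, or covered by its two halves. *)
Lemma bisect_sound fuel (k1 k2 u1 u2 : Z) (k u : R) : bisect one prec fuel k1 k2 u1 u2 ->
  (0 <= k1 <= k2)%Z -> (2 * k2 <= one)%Z -> (0 <= u1)%Z ->
  fx k1 <= k <= fx k2 -> fx u1 <= u <= fx u2 -> 4 * k * (1 + u - k) <= 1 ->
  certified 4 k u \/ certified 11 k u.
Proof.
elim: fuel k1 k2 u1 u2 => [//|fuel IH] k1 k2 u1 u2 /= B k10 k2h u10 kb ub dom.
have o0 := @one_gt0 R one one_pos.
have [k1p k12] := k10.
have /andP[k1k kk2] := kb; have /andP[u1u uu2] := ub.
have k1p' := fx_ge0 one one_pos k1 k1p (R := R).
have u10' := fx_ge0 one one_pos u1 u10 (R := R).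
have kh : k <= 2^-1.
  by have /andP[] := box_range one one_pos k1 k2 k k1p k2h kb.
have u0 : 0 <= u by apply: le_trans u1u.
move: B; case: Z.ltb_spec => [ex _|_].
  have e4 : zr 4 = 4 :> R := zr_pos 4.
  exfalso; have := zr_lt _ _ ex (R := R); rewrite !(zrM, zrB, zrD) e4.
  have : 4 * fx k1 * (1 + fx u1 - fx k1) <= 1.
    apply: le_trans dom.
    (* k (1 + u - k) grows with k here, because k + k1 <= 1; the constraint therefore passes to the
       corner ([k1], [u1]), contradicting the test. *)
    have : (k - fx k1) * (1 + u - k - fx k1) >= 0 by apply: mulr_ge0; lra.
    have : 0 <= fx k1 * (u - fx u1) by apply: mulr_ge0; lra.
    by lra.
  rewrite -(ler_pM2r (exprn_gt0 2 o0)).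
  rewrite [leLHS](_ : _ = 4 * zr k1 * (zr one + zr u1 - zr k1)); last first.
    by rewrite /fx; field; rewrite gt_eqF.
  by rewrite mul1r expr2 ltNge => ->.
set u3 := if (0 <? k1)%Z
  then Z.min u2 ((one - 2 * k1) * (one - 2 * k1) / (4 * k1) + 1)%Z else u2.
have ub3 : fx u1 <= u <= fx u3.
  rewrite u1u /= /u3; case: Z.ltb_spec => // k1gt.
  have S := strain_bound k1 k u k1gt k1k kh u0 dom.
  by case: (Z.min_spec u2 ((one - 2 * k1) * (one - 2 * k1) / (4 * k1) + 1)%Z) => -[_ ->].
set N := if (49 * one <=? 100 * k1)%Z then 11%nat else 4%nat.
case bo : box_ok.
  move=> _; have N0 : (0 < N)%nat by rewrite /N; case: ifP.
  have := box_ok_sound one one_pos prec shiftE N k1 k2 u1 u3 k u N0 k1p k2h kb u10 ub3 bo.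
  by rewrite /N; case: ifP => _ ?; [right|left].
clearbody u3; case: ifP => _; case b1 : bisect => // b2.
- have u31 : (0 <= (u1 + u3) / 2)%Z.
    apply: Z.div_pos => //; have : (u1 <= u3)%Z; last by clear -u10; lia.
    case: (Z.le_gt_cases u1 u3) => // /(zr_lt (R := R)) h.
    have /andP[h1 h2] := ub3; have := le_trans h1 h2.
    by rewrite /fx ler_pM2r ?invr_gt0// leNgt h.
  by case/orP: (fx_mid _ _ _ ub3) => ub'; [apply: (IH k1 k2 u1 _ b1)|apply: (IH k1 k2 _ u3 b2)].
- have c1 : (k1 <= (k1 + k2) / 2)%Z by clear -k12; apply: Z.div_le_lower_bound; lia.
  have c2 : ((k1 + k2) / 2 <= k2)%Z by clear -k12; apply: Z.div_le_upper_bound; lia.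
  case/orP: (fx_mid _ _ _ kb) => kb'.
    by apply: (IH k1 _ u1 u3 b1) => //; clear -k10 k2h c1 c2; lia.
  by apply: (IH _ k2 u1 u3 b2) => //; clear -k10 k2h c1 c2; lia.
Qed.

End Bisection.

Definition scale : Z := (2 ^ 33)%Z.

(** The box is k in [0, 1/2] and u in [0, 1/5], the end 1/5 being rounded up to the grid. [bisect]
    uses nested [if] so that evaluation does not enter the halves of a box that has already
    passed. *)
Lemma bisect_run : bisect scale 33 25 0 (scale / 2) 0 (scale / 5 + 1).
Proof. by vm_compute. Qed.

(** * Large u, and the monotonicity of S_3 *)

Definition coarse_ok (one prec : Z) : bool :=
  let k := (27 * one / 100 + 1)%Z in
  [&& (2 * k <=? one)%Z,
      (100 * wsum_up one prec 0 k 5 one 0 0 4 <=? 166 * one)%Z,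
      (100 * wsum_up one prec 0 k 5 0 one 0 4 <=? 7 * one)%Z,
      (100 * wsum_up one prec 0 k 7 0 0 one 4 <=? 32 * one)%Z,
      (100 * axsum_up one prec 4 6 <=? 102 * one)%Z &
      (2 * (one / 2) =? one)%Z && (1 * wsum_up one prec 0 (one / 2) 4 0 0 one 4 <=? 5 * one)%Z].

Section Coarse.
Context {R : realType} (one : Z) (one_pos : (0 < one)%Z).
Context (prec : Z) (shiftE : forall a, Z.shiftr a prec = (a / one)%Z).
Context (ok : coarse_ok one prec).

Local Notation fx := (@fx R one).

Lemma fx_le_ratio (p q : positive) (z : Z) (x : R) : ubd one z x ->
  (Zpos p * z <=? Zpos q * one)%Z -> x <= (Pos.to_nat q)%:R / (Pos.to_nat p)%:R.
Proof.
move=> [_ xz] /Z.leb_le /(zr_le (R := R)); rewrite !zrM !zr_pos => H.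
have p0 : 0 < (Pos.to_nat p)%:R :> R by rewrite ltr0n; lia.
have o0 := @one_gt0 R one one_pos.
apply: le_trans xz _; rewrite ler_pdivlMr// /fx mulrAC ler_pdivrMr//; lra.
Qed.

Lemma zero_ubd : ubd one 0 0 (R := R). Proof. by split; rewrite // /fx zr0 mul0r. Qed.

Lemma unit_ubd : ubd one one 1 (R := R). Proof. by split; rewrite ?fx1. Qed.

Lemma coarse_bounds (k : R) : 0 <= k <= 27 / 100 ->
  [/\ wsum 4 k 1 0 0 5 <= 166 / 100, wsum 4 k 0 1 0 5 <= 7 / 100,
      wsum 4 k 0 0 1 7 <= 32 / 100 & axsum 4 6 <= 102 / 100 :> R].
Proof.
move=> /andP[k0 k27]; move: ok => /and5P[/Z.leb_le kh A B C /andP[D _]].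
have z0 := zero_ubd; have o1 := unit_ubd.
have kb : fx 0 <= k <= fx (27 * one / 100 + 1)%Z.
  rewrite /fx zr0 mul0r k0 /=; apply: le_trans k27 _.
  have /andP[_ h] := zr_div (27 * one) 100 erefl (R := R).
  have o0 := @one_gt0 R one one_pos.
  rewrite ler_pdivlMr//; apply: le_trans h; rewrite zrM.
  have e27 : zr 27 = 27 :> R := zr_pos 27.
  have e100 : zr 100 = 100 :> R := zr_pos 100.
  rewrite e27 e100; lra.
have W al be ga s x y z := @wsum_up_ok R one one_pos prec shiftE 0 _ k
  (Z.le_refl 0) kh kb al be ga x y z s 4.
split.
- exact: fx_le_ratio (W _ _ _ 5%positive _ _ _ o1 z0 z0) A.
- exact: fx_le_ratio (W _ _ _ 5%positive _ _ _ z0 o1 z0) B.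
- exact: fx_le_ratio (W _ _ _ 7%positive _ _ _ z0 z0 o1) C.
- exact: fx_le_ratio (axsum_up_ok one one_pos prec shiftE 4 6) D.
Qed.

Lemma axsum_ge1 N j : 1 <= axsum N.+1 j :> R.
Proof.
rewrite /axsum /= big_cons invr1 expr1n lerDl.
by apply: sumr_ge0 => i _; rewrite exprn_ge0.
Qed.

(** Far from tight: the axis gives at least 36, against at most 15 from the off-axis terms and less
    than 1/10 from the tail. *)
Lemma lower3_ge0 (k : R) : 0 <= k <= 2^-1 -> 0 <= lower3 4 k.
Proof.
move=> /andP[k0 kh]; move: ok => /and5P[_ _ _ _ /andP[_ /andP[/Z.eqb_eq h2 E]]].
have z0 := zero_ubd; have o1 := unit_ubd.
have kb : fx 0 <= k <= fx (one / 2)%Z.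
  rewrite /fx zr0 mul0r k0 /= -/(fx _).
  have : fx (2 * (one / 2))%Z = 1 by rewrite h2 fx1.
  by rewrite fxZ zr2; lra.
have hh : (2 * (one / 2) <= one)%Z by lia.
have := fx_le_ratio _ _ _ _ (wsum_up_ok one one_pos prec shiftE 0 _ k (Z.le_refl 0) hh kb
  0 0 one 0 0 1 4 4 z0 z0 o1) E.
rewrite divr1 => X5; rewrite /lower3 /tail.
have := axsum_ge1 3 6.
have X5' : wsum 4 k 0 0 1 4 <= 5 by exact: X5.
lra.
Qed.

Lemma weight_nonneg N (k x y z : R) s : 0 <= k <= 2^-1 -> 0 <= x -> 0 <= y -> 0 <= z ->
  0 <= wsum N k x y z s.
Proof.
move=> k12 x0 y0 z0; rewrite /wsum /offsum big_seq; apply: sumr_ge0 => -[a b] /=.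
move=> /allpairsPdep[c [d [/[!mem_iota] cN _ [-> _]]]].
have c0 : (c%:R != 0 :> R) by rewrite pnatr_eq0; lia.
have T (n : R) : 0 <= wterm k x y z s c%:R n.
  apply: mulr_ge0.
    have p0 := addr_ge0 (sqr_ge0 (c%:R : R)) (sqr_ge0 n).
    exact: addr_ge0 (addr_ge0 (mulr_ge0 x0 (sqr_ge0 _)) (mulr_ge0 y0 (sqr_ge0 _)))
      (mulr_ge0 z0 p0).
  rewrite exprn_ge0// invr_ge0 ltW// form_gt0 ?c0//; exact: ksq_lt1.
by rewrite mulr_ge0// addr_ge0.
Qed.

Lemma wsum_linear N (k x y : R) s :
  wsum N k x y 0 s = x * wsum N k 1 0 0 s + y * wsum N k 0 1 0 s.
Proof.
rewrite /wsum /offsum !mulr_sumr -big_split; apply: eq_bigr => ab _.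
by rewrite /wterm /=; ring.
Qed.

(** The right side has degree 5 in u, the left side 4. In v = u - 1/5 the only negative coefficient
    of the difference is that of v^4, about -104; the positive quadratic in [v3] absorbs it into its
    neighbours. *)
Lemma large_strain_poly (u t : R) : 1 / 5 <= u -> t = 27 / 20 + 3 * u ->
  306 / 100 * (102 / 25 * cheb u + 6 * t ^+ 3 * (9 / 5 * u + 7 / 40)) <=
  22 / 25 * (4 * (cheb u * (4 + 2 * u * cheb u)) - 2).
Proof.
move=> u5 ->; have [v v0 ->] : exists2 v, 0 <= v & u = 1 / 5 + v.
  by exists (u - 1 / 5); [lra|ring].
rewrite /cheb.
have v2 := sqr_ge0 v.
have v3 : 0 <= v ^+ 3 * (101 - 104 * v + 112 * v ^+ 2).
  by apply: mulr_ge0; [exact: exprn_ge0|nra].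
have v4 : 0 <= v ^+ 5 by exact: exprn_ge0.
have v5 : 0 <= v ^+ 4 by exact: exprn_ge0.
have v6 : 0 <= v ^+ 3 by exact: exprn_ge0.
lra.
Qed.

(** As 1 - k^2 = h^2, the second bound says h^3 >= 22/25. *)
Lemma cosine_bounds (k : R) : 0 <= k <= 27 / 100 ->
  23 / 25 <= 1 - k ^+ 2 /\ (22 / 25) ^+ 2 <= (1 - k ^+ 2) ^+ 3.
Proof.
move=> k27; have k3 : 23 / 25 <= 1 - k ^+ 2 by nra.
split=> //; apply: (@le_trans _ _ ((23 / 25) ^+ 3)); first by lra.
by rewrite lerXn2r ?nnegrE//; lra.
Qed.

(** The difference is 2.28 u^2 - 0.768 u + 0.1127, with negative discriminant and minimum near u =
    17/100. *)
Lemma large_distortion (u : R) : 1 / 5 <= u ->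
  2 * u * (27 / 20 + 3 * u) <= (27 / 20 + 3 * u - 1) ^+ 2 * (23 / 25).
Proof. by move=> u5; have := sqr_ge0 (u - 17 / 100); lra. Qed.

Lemma certified_large (k u : R) : 0 <= k <= 2^-1 -> 1 / 5 <= u ->
  4 * k * (1 + u - k) <= 1 -> certified 4 k u.
Proof.
move=> k12 u5 dom; have /andP[k0 kh] := k12.
(* At k = 27/100 and u = 1/5 one already has 4 k (1 + u - k) = 1.0044. *)
have k27 : k <= 27 / 100.
  by rewrite leNgt; apply/negP => k27; nra.
have [X1 X2 Y3 A] := coarse_bounds k (introT andP (conj k0 k27)).
pose t := 27 / 20 + 3 * u.
(* 9/5 u + 7/40 rounds up 1.66 u + 0.07 (2 + u) plus the tail; the 2 subtracted in [L] covers 6 *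
   0.32 and the tail of [lower6]. *)
pose U := 102 / 25 * cheb u + 6 * t ^+ 3 * (9 / 5 * u + 7 / 40).
pose L := 4 * (cheb u * (4 + 2 * u * cheb u)) - 2.
have LU : 306 / 100 * U <= 22 / 25 * L by exact: large_strain_poly.
have c9 : 9 <= cheb u by rewrite /cheb; have := sqr_ge0 u; lra.
have t3 : 0 <= t ^+ 3 by rewrite exprn_ge0// /t; lra.
have U0 : 0 <= U.
  apply: addr_ge0; first by lra.
  by apply: mulr_ge0; [rewrite mulr_ge0|lra].
have tl : tail 4 = 1 / 200 :> R by rewrite /tail; field.
have [k3 h3] := cosine_bounds k (introT andP (conj k0 k27)).
exists t, U, L; split.
- rewrite /t; lra.
- apply: le_trans (large_distortion u u5) _.
  by apply: ler_wpM2l => //; exact: sqr_ge0.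
- rewrite /upper3 wsum_linear tl.
  have X0 := weight_nonneg 4 k 0 0 1 4 k12 (lexx _) (lexx _) ler01.
  have H1 : 4 * cheb u * axsum 4 6 <= 102 / 25 * cheb u.
    have : cheb u * axsum 4 6 <= cheb u * (102 / 100) by apply: ler_wpM2l A; lra.
    by lra.
  have H2 : 6 * t ^+ 3 * (u * wsum 4 k 1 0 0 5 + (2 + u) * wsum 4 k 0 1 0 5) <=
     6 * t ^+ 3 * (u * (166 / 100) + (2 + u) * (7 / 100)).
    apply: ler_wpM2l; first by rewrite mulr_ge0.
    by apply: lerD; apply: ler_wpM2l => //; lra.
  have H3 : 6 * t ^+ 3 * ((u * (166 / 100) + (2 + u) * (7 / 100)) +
      (4 * u + 4 / 3 * (2 + u)) * (64 / 27) * (1 / 200)) <=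
      6 * t ^+ 3 * (9 / 5 * u + 7 / 40).
    by apply: ler_wpM2l; [rewrite mulr_ge0|lra].
  rewrite /U; lra.
- apply/andP; split; first by lra.
  rewrite /lower6 tl.
  have Y0 := weight_nonneg 4 k 0 1 0 8 k12 (lexx _) ler01 (lexx _).
  have H1 : 0 <= 42 * t^-1 ^+ 6 * wsum 4 k 0 1 0 8.
    by rewrite mulr_ge0// mulr_ge0// exprn_ge0// invr_ge0 /t; lra.
  have H2 : cheb u * (4 + 2 * u * cheb u) <= cheb u * (4 + 2 * u * cheb u) * axsum 4 12.
    rewrite -[leLHS]mulr1; apply: ler_wpM2l (axsum_ge1 3 12).
    by apply: mulr_ge0; [lra|apply: addr_ge0 => //; apply: mulr_ge0; lra].
  rewrite /L; lra.
- apply: le_trans (ler_wpM2r (sqr_ge0 L) h3).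
  have U1 : 0 <= 306 / 100 * U
    by exact: mulr_ge0 (divr_ge0 (ler0n _ _) (ler0n _ _)) U0.
  by rewrite -!exprMn lerXn2r ?nnegrE// (le_trans U1).
Qed.

End Coarse.

(** * Comparison with the arc *)

Lemma scale_gt0 : (0 < scale)%Z. Proof. by []. Qed.

Lemma scale_shift a : Z.shiftr a 33 = (a / scale)%Z.
Proof. by rewrite Z.shiftr_div_pow2. Qed.

Lemma coarse_run : coarse_ok scale 33. Proof. by vm_compute. Qed.

Lemma scale_half : (2 * (scale / 2) = scale)%Z. Proof. by vm_compute. Qed.

Section Projection.
Context {R : realType}.
Implicit Types (k h r u : R).

Lemma bisect_start (one : Z) (one_pos : (0 < one)%Z) (prec : Z)
    (shiftE : forall a, Z.shiftr a prec = (a / one)%Z) fuel k u :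
  bisect one prec fuel 0 (one / 2) 0 (one / 5 + 1) -> (2 * (one / 2) = one)%Z ->
  0 <= k <= 2^-1 -> 0 <= u <= 1 / 5 -> 4 * k * (1 + u - k) <= 1 ->
  certified 4 k u \/ certified 11 k u.
Proof.
move=> run half k12 /andP[u0 u5] dom.
have o0 := @one_gt0 R _ one_pos.
have f0 : fx one 0 = 0 :> R by rewrite /fx zr0 mul0r.
apply: (bisect_sound _ one_pos _ shiftE _ _ _ _ _ _ _ run).
- by split; [exact: Z.le_refl|apply: Z.div_pos; lia].
- by rewrite half; exact: Z.le_refl.
- exact: Z.le_refl.
- have /andP[k0 kh] := k12; rewrite f0 k0 /=.
  have : fx one (2 * (one / 2))%Z = 1 :> R by rewrite half fx1.
  by rewrite fxZ zr2; lra.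
- rewrite f0 u0 /=; apply: le_trans u5 _.
  have /andP[_ D] := zr_div one 5 erefl (R := R).
  have e5 : zr 5 = 5 :> R := zr_pos 5.
  by rewrite e5 in D; rewrite /fx ler_pdivlMr//; lra.
- exact: dom.
Qed.

Lemma certified_all k u : 0 <= k <= 2^-1 -> 0 <= u -> 4 * k * (1 + u - k) <= 1 ->
  certified 4 k u \/ certified 11 k u.
Proof.
move=> k12 u0 dom; have [u5|/ltW u5] := leP (1 / 5) u.
  by left; exact: (certified_large _ scale_gt0 _ scale_shift coarse_run).
apply: (bisect_start _ scale_gt0 _ scale_shift _ _ _ bisect_run scale_half) => //.
by rewrite u0.
Qed.

Lemma certified_ineq N k r h : orbits_cover N -> (0 < N)%nat -> 1 <= r ->
  0 <= k <= 2^-1 -> 0 < h -> k ^+ 2 + h ^+ 2 = 1 ->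
  certified N k (strain r) ->
  306 / 100 * (form_zeta 3 r k - form_zeta 3 1 k) <=
  h ^+ 3 * (form_zeta 6 r k - form_zeta 6 1 k).
Proof.
move=> cov N0 r1 k12 h0 kh [t [U [L [t1 td UU /andP[L0 LL] UL]]]].
have r0 : 0 < r by lra.
have u0 := strain_ge0 r r0.
have T : distortion r k t by split.
have A := form_zeta3_le N r k t cov N0 r1 k12 T.
have B := form_zeta6_ge 4 r k t orbits_cover4 isT r1 k12 T.
have h3 : 0 <= h ^+ 3 by rewrite exprn_ge0// ltW.
have UL' : 306 / 100 * U <= h ^+ 3 * L.
  have hL : 0 <= h ^+ 3 * L by exact: mulr_ge0.
  rewrite leNgt; apply/negP => lt.
  have : (h ^+ 3 * L) ^+ 2 < (306 / 100 * U) ^+ 2.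
    by rewrite ltrXn2r ?nnegrE//; lra.
  rewrite ltNge (_ : (h ^+ 3 * L) ^+ 2 = (1 - k ^+ 2) ^+ 3 * L ^+ 2); last first.
    by rewrite (_ : 1 - k ^+ 2 = h ^+ 2); [ring|lra].
  by rewrite (exprMn 2 (306 / 100) U) UL.
have A1 := ler_wpM2l u0 UU; have B1 := ler_wpM2l u0 LL.
have A2 : form_zeta 3 r k - form_zeta 3 1 k <= strain r * U by lra.
have B2 : strain r * L <= form_zeta 6 r k - form_zeta 6 1 k by lra.
have := ler_wpM2l h3 B2; have := ler_wpM2l u0 UL'; lra.
Qed.

Lemma projection_le k r h b : 1 <= r -> 0 <= k -> 2 * k * r <= 1 ->
  0 < h -> k ^+ 2 + h ^+ 2 = 1 -> b <= 306 / 100 ->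
  h ^+ 6 * form_zeta 6 1 k - b * (h ^+ 3 * form_zeta 3 1 k) <=
  h ^+ 6 * form_zeta 6 r k - b * (h ^+ 3 * form_zeta 3 r k).
Proof.
move=> r1 k0 kr h0 kh b306.
have r0 : 0 < r by lra.
have k12 : 0 <= k <= 2^-1 by rewrite k0 /=; nra.
have u0 := strain_ge0 r r0.
have dom : 4 * k * (1 + strain r - k) <= 1.
  have e : 1 + strain r = (r + r^-1) / 2.
    by rewrite /strain; field; rewrite gt_eqF.
  have rr : r * r^-1 = 1 by rewrite divff// gt_eqF.
  have v0 : 0 <= r^-1 by rewrite invr_ge0 ltW.
  have v1 : r^-1 <= 1 by rewrite invf_le1.
  have : 0 <= (1 - 2 * k * r) * (1 - 2 * k * r^-1) by apply: mulr_ge0; nra.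
  by rewrite e; nra.
have D3 : 0 <= form_zeta 3 r k - form_zeta 3 1 k.
  apply: le_trans (form_zeta3_ge 4 r k orbits_cover4 isT r1 k12).
  apply: mulr_ge0 => //.
  exact: (lower3_ge0 _ scale_gt0 _ scale_shift coarse_run).
have M : 306 / 100 * (form_zeta 3 r k - form_zeta 3 1 k) <=
    h ^+ 3 * (form_zeta 6 r k - form_zeta 6 1 k).
  have [C|C] := certified_all k (strain r) k12 u0 dom.
    exact: (certified_ineq 4).
  exact: (certified_ineq 11 _ _ _ orbits_cover11).
have h3 : 0 <= h ^+ 3 by rewrite exprn_ge0// ltW.
have M' : b * (form_zeta 3 r k - form_zeta 3 1 k) <=
    h ^+ 3 * (form_zeta 6 r k - form_zeta 6 1 k).
  by apply: le_trans M; apply: ler_wpM2r.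
have := ler_wpM2l h3 M'; rewrite (exprD h 3 3); lra.
Qed.

Lemma lattice_term n z k h r p : 0 < r -> 0 < h -> k ^+ 2 + h ^+ 2 = 1 ->
  z.1 = r * k -> z.2 = r * h -> p != 0 ->
  (z.2 `^ n%:R) / ((latnorm2 z p.1 p.2) `^ n%:R) = h ^+ n * form_pow n r k p.
Proof.
move=> r0 h0 kh z1 z2 p0.
have e : latnorm2 z p.1 p.2 = r * form r k p.1%:~R p.2%:~R.
  have rh : (p.1%:~R * (r * h)) ^+ 2 = p.1%:~R ^+ 2 * r ^+ 2 * (1 - k ^+ 2).
    by rewrite !exprMn (_ : h ^+ 2 = 1 - k ^+ 2); [ring|lra].
  by rewrite /latnorm2 z1 z2 /form rh; field; rewrite gt_eqF.
have f0 : 0 < form r k (p.1%:~R : R) p.2%:~R.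
  by apply: form_gt0 (coord_neq0 p p0) => //; nra.
have a1 : 0 <= r * h := ltW (mulr_gt0 r0 h0).
have a2 : 0 <= r * form r k p.1%:~R p.2%:~R := ltW (mulr_gt0 r0 f0).
rewrite z2 e !powR_mulrn// /form_pow -[RHS]exprMn -expr_div_n.
by congr (_ ^+ _); field; rewrite !gt_eqF.
Qed.

Lemma epstein_polar n z k h r : (3 <= n)%nat -> 1 <= r -> 0 < h -> k ^+ 2 + h ^+ 2 = 1 ->
  z.1 = r * k -> z.2 = r * h ->
  epstein_zeta n%:R z = h ^+ n * form_zeta n r k.
Proof.
move=> n3 r1 h0 kh z1 z2; have r0 : 0 < r by lra.
have k1 : k ^+ 2 < 1 by nra.
have [B HB] := form_pow_summed n r k n3 r1 k1.
rewrite /form_zeta -(lattice_sumZ _ _ B)//; last 2 first.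
- exact: exprn_gt0.
- exact: form_pow_ge0.
congr fine; apply: eq_esum => p p0; congr EFin.
exact: lattice_term.
Qed.

(** [Gamma_b] contains both halves of the arc, while the closure of [DG] meets only the right one.
    The reflection (m, n) -> (-m, n) exchanges k and -k. *)
Lemma form_zetaN n r k : form_zeta n r (- k) = form_zeta n r k.
Proof.
pose f (p : int * int) := (- p.1, p.2).
rewrite /form_zeta -[RHS](lattice_sum_bij f).
- apply: eq_lattice_sum => p _; rewrite /form_pow /form /f /= mulrNz sqrrN.
  by congr (_ ^-1 ^+ _); ring.
- by move=> [a b] [c d] [/oppr_inj -> ->].
- by move=> p; rewrite /supnorm /f /= abszN.
- by move=> [a b]; exists (- a, b); rewrite /f /= opprK.
Qed.

End Projection.

(** * Continuity on the arc and existence of a minimum *)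

Section Minimum.
Context {R : realType}.
Implicit Types (k h r b : R) (z : R * R).

Lemma form1_lipschitz k k' (m n : R) : 0 <= k' <= 2^-1 ->
  `|form 1 k m n - form 1 k' m n| <= 2 * `|k - k'| * form 1 k' m n.
Proof.
move=> k12; have T := trace_le k' m n k12.
rewrite [X in `|X|](_ : _ = (k - k') * (2 * (m * n))); last by rewrite !form1E; ring.
rewrite normrM [leRHS](_ : _ = `|k - k'| * (2 * form 1 k' m n)); last by ring.
apply: ler_wpM2l => //; apply: le_trans T.
have := sqr_ge0 (m + n); have := sqr_ge0 (m - n).
by rewrite ler_norml => ? ?; apply/andP; split; lra.
Qed.

Lemma inv_pow_lipschitz s (x y d : R) : s \in [:: 3; 6] -> 0 < x -> 0 < y ->
  `|x - y| <= d * y -> y^-1 ^+ s <= x^-1 ^+ s + 6 * d * y^-1 ^+ s.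
Proof.
move=> s36 x0 y0 xy.
have d0 : 0 <= d by rewrite -(pmulr_lge0 _ y0) (le_trans _ xy).
have c : (x - y) * y^-1 <= d by rewrite ler_pdivrMr// (le_trans (ler_norm _) xy).
have y1 : 0 <= y^-1 by rewrite invr_ge0 ltW.
have yn n : 0 <= y^-1 ^+ n by exact: exprn_ge0.
move: s36; rewrite !inE => /orP[] /eqP ->.
- have := inv3_ge_tangent x y x0 y0.
  rewrite exprS [3 * (x - y) * _]mulrA -[3 * _ * _]mulrA.
  have := ler_wpM2r (yn 3) c; have := mulr_ge0 d0 (yn 3); lra.
(* Any t above both 1 and x / y would do: the quadratic term it controls is dropped at once. *)
- have t1 : 1 <= 1 + x / y by rewrite lerDl divr_ge0 ?ltW.
  have xt : x <= (1 + x / y) * y by rewrite mulrDl divfK ?gt_eqF// mul1r lerDr ltW.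
  have := inv6_ge_tangent _ x y x0 y0 t1 xt.
  have : 0 <= 21 * (1 + x / y)^-1 ^+ 6 * (x - y) ^+ 2 * y^-1 ^+ 8.
    rewrite mulr_ge0// mulr_ge0 ?sqr_ge0// mulr_ge0// exprn_ge0// invr_ge0.
    by apply: le_trans t1.
  rewrite (exprS _ 6) [6 * (x - y) * _]mulrA -[6 * _ * _]mulrA.
  have := ler_wpM2r (yn 6) c; have := mulr_ge0 d0 (yn 6); lra.
Qed.

(** Each term is Lipschitz in k with a constant of order the sixth inverse power of the sup-norm,
    and [lattice_sum_compare] with N = 1 sums these constants. The one-sided estimate suffices, as k
    and k' may be exchanged. *)
Lemma form_zeta_lipschitz s : s \in [:: 3; 6] -> exists2 C : R, 0 <= C &
  forall k k', 0 <= k <= 2^-1 -> 0 <= k' <= 2^-1 ->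
  form_zeta s 1 k' <= form_zeta s 1 k + C * `|k - k'|.
Proof.
move=> s36; have s3 : (3 <= s)%nat by move: s36; rewrite !inE => /orP[] /eqP ->.
have s6 : (6 <= 2 * s)%nat by rewrite (leq_mul2l 2 3).
pose D : R := 12 * (4 / 3) ^+ s.
have D0 : 0 <= D by rewrite mulr_ge0// exprn_ge0// divr_ge0.
exists (D * (\sum_(p <- punctured 1) (supnorm p)%:R^-1 ^+ 6 + 2 / (1%:R * 2%:R) ^+ 2)).
  rewrite mulr_ge0// addr_ge0 ?divr_ge0 ?exprn_ge0//.
  by apply: sumr_ge0 => p _; rewrite exprn_ge0.
move=> k k' k12 k12'; have k1 := ksq_lt1 k k12; have k1' := ksq_lt1 k' k12'.
have pt p : p != 0 -> form_pow s 1 k' p <=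
    form_pow s 1 k p + D * `|k - k'| * (supnorm p)%:R^-1 ^+ 6.
  move=> p0; have x0 := form_gt0 1 k _ _ ltr01 k1 (coord_neq0 (R := R) p p0).
  have y0 := form_gt0 1 k' _ _ ltr01 k1' (coord_neq0 (R := R) p p0).
  have L := form1_lipschitz k k' p.1%:~R p.2%:~R k12'.
  apply: le_trans (inv_pow_lipschitz s _ _ _ s36 x0 y0 L) _.
  rewrite lerD2l /D.
  have I := form1_inv_supnorm k' p s k12' p0.
  have I' : (supnorm p)%:R^-1 ^+ (2 * s) <= (supnorm p)%:R^-1 ^+ 6 :> R.
    by have /andP[? ?] := supnorm_inv_le1 (R := R) p p0; rewrite ler_wiXn2l.
  have c0 : 0 <= 12 * `|k - k'| by rewrite mulr_ge0.
  rewrite [leLHS](_ : _ = 12 * `|k - k'| * (form 1 k' p.1%:~R p.2%:~R)^-1 ^+ s); last by ring.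
  rewrite [leRHS](_ : _ =
    12 * `|k - k'| * ((4 / 3) ^+ s * (supnorm p)%:R^-1 ^+ 6)); last by ring.
  apply: ler_wpM2l c0 _ _ _; apply: le_trans I _.
  by rewrite ler_wpM2l// exprn_ge0// divr_ge0.
have [B HB] := form_pow_summed s 1 k s3 (lexx _) k1.
have E0 : 0 <= D * `|k - k'| by rewrite mulr_ge0.
have dom : dominated (form_pow s 1 k') (form_pow s 1 k) (D * `|k - k'|) 1.
  by move=> p p1; apply: pt; rewrite -supnorm_gt0 ltnW.
have := lattice_sum_compare 1 _ _ _ B isT E0 (form_pow_ge0 s 1 k' ltr01 k1')
  (form_pow_ge0 s 1 k ltr01 k1) HB dom.
have S : \sum_(p <- punctured 1) (form_pow s 1 k' p - form_pow s 1 k p) <=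
    D * `|k - k'| * \sum_(p <- punctured 1) (supnorm p)%:R^-1 ^+ 6.
  rewrite mulr_sumr big_seq [leRHS]big_seq; apply: ler_sum => p.
  by rewrite mem_punctured lerBlDl => /andP[/pt].
rewrite -/(form_zeta s 1 k) -/(form_zeta s 1 k'); lra.
Qed.

(** The Lipschitz bound is known only for k in [0, 1/2]; composing with the projection onto this
    interval gives a function continuous on the whole line. *)
Definition clamp k : R := Num.max 0 (Num.min k 2^-1).

Lemma clamp_range k : 0 <= clamp k <= 2^-1.
Proof.
rewrite /clamp le_max lexx /= ge_max ge_min lexx orbT andbT.
by rewrite invr_ge0.
Qed.

Lemma clamp_id k : 0 <= k <= 2^-1 -> clamp k = k.
Proof. by move=> /andP[k0 kh]; rewrite /clamp min_l// max_r. Qed.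

Lemma clamp_lipschitz k k' : `|clamp k - clamp k'| <= `|k - k'|.
Proof.
have h1 := ler_norm (k - k'); have h2 := ler_norm (k' - k); rewrite distrC in h2.
rewrite /clamp ler_norml; move: h1 h2; set d := `|k - k'|; clearbody d => h1 h2.
have i0 : 0 < 2^-1 :> R by rewrite invr_gt0.
by case: (leP k 2^-1) => ?; case: (leP k' 2^-1) => ?; case: (leP 0 k) => ?;
  case: (leP 0 k') => ?; rewrite ?(max_r (ltW i0)); apply/andP; split; lra.
Qed.

Lemma lipschitz_continuous (f : R -> R) C : 0 <= C ->
  (forall x y, f y <= f x + C * `|x - y|) -> continuous f.
Proof.
move=> C0 fC x; apply/cvgrPdist_lt => e e0; near=> y.
have d : `|x - y| < e / (C + 1).
  near: y; apply: (@cvgr_dist_lt _ _ _ (nbhs x) _ id x) => //.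
  by rewrite divr_gt0//; lra.
have h1 := fC x y; have h2 := fC y x; rewrite distrC in h2.
have d0 : 0 <= `|x - y| by [].
have lt : C * `|x - y| < e.
  apply: le_lt_trans (_ : (C + 1) * `|x - y| < e); first by rewrite ler_wpM2r//; lra.
  by rewrite mulrC -ltr_pdivlMr//; lra.
rewrite ltr_norml; lra.
Unshelve. all: by end_near. Qed.

Definition arc_energy b k : R :=
  Num.sqrt (1 - k ^+ 2) ^+ 6 * form_zeta 6 1 k
  - b * (Num.sqrt (1 - k ^+ 2) ^+ 3 * form_zeta 3 1 k).

Lemma arc_energy_min b : exists2 k, 0 <= k <= 2^-1 &
  forall k', 0 <= k' <= 2^-1 -> arc_energy b k <= arc_energy b k'.
Proof.
have cont s : s \in [:: 3; 6] -> continuous (fun k => form_zeta s 1 (clamp k) : R).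
  move=> /form_zeta_lipschitz[C C0 L]; apply: (lipschitz_continuous _ C) => // x y.
  apply: le_trans (L _ _ (clamp_range x) (clamp_range y)) _.
  by rewrite lerD2l ler_wpM2l// clamp_lipschitz.
have csqrt n : continuous (fun k : R => Num.sqrt (1 - k ^+ 2) ^+ n).
  move=> x; apply: (@continuous_comp R R R (fun k => Num.sqrt (1 - k ^+ 2)) (fun y => y ^+ n)).
    apply: (@continuous_comp R R R (fun k => 1 - k ^+ 2) Num.sqrt).
      by apply: cvgB; [exact: cvg_cst|exact: exprn_continuous].
    exact: sqrt_continuous.
  exact: exprn_continuous.
pose f k : R := Num.sqrt (1 - k ^+ 2) ^+ 6 * form_zeta 6 1 (clamp k)
  - b * (Num.sqrt (1 - k ^+ 2) ^+ 3 * form_zeta 3 1 (clamp k)).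
have cf : continuous f.
  move=> x; apply: cvgB; first by apply: cvgM; [exact: csqrt|exact: cont].
  apply: cvgM; first exact: cvg_cst.
  by apply: cvgM; [exact: csqrt|exact: cont].
have [|k kI kmin] := @EVT_min R f 0 2^-1 _ (continuous_subspaceT cf).
  by rewrite invr_ge0.
move: kI; rewrite in_itv /= => kI; exists k => // k' kI'.
have := kmin k'; rewrite in_itv /= => /(_ kI').
by rewrite /f !clamp_id.
Qed.

End Minimum.

(** * The closed domain and the two minima *)

Section Final.
Context {R : realType}.
Implicit Types (k h r b : R) (z w : R * R).

Lemma closure_ge (A : set (R * R)) (f : R * R -> R) c z :
  {for z, continuous f} -> (forall w, A w -> c <= f w) -> closure A z -> c <= f z.
Proof.
move=> fz Ac clA; rewrite leNgt; apply/negP => fc.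
have [w [/Ac cw /= wc]] := clA _ (cvgr_lt _ fz _ fc).
by move: (le_lt_trans cw wc); rewrite ltxx.
Qed.

Lemma closure_DG z : closure (@DG R) z ->
  [/\ 0 < z.2, 1 <= z.1 ^+ 2 + z.2 ^+ 2, 0 <= z.1 & z.1 <= 2^-1].
Proof.
move=> clz.
have c1 : {for z, continuous (fun w : R * R => w.1)} by exact: cvg_fst.
have c2 : {for z, continuous (fun w : R * R => w.2)} by exact: cvg_snd.
have x0 : 0 <= z.1.
  by apply: closure_ge c1 _ clz => w [_ [_ [/ltW]]].
have x1 : z.1 <= 2^-1.
  rewrite -lerN2; apply: (closure_ge _ (fun w => - w.1)) clz; first exact: cvgN.
  by move=> w [_ [_ [_ /ltW]]]; rewrite lerN2.
have y0 : 0 <= z.2.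
  by apply: closure_ge c2 _ clz => w [/ltW].
have n1 : 1 <= z.1 ^+ 2 + z.2 ^+ 2.
  apply: (closure_ge _ (fun w => w.1 ^+ 2 + w.2 ^+ 2)) clz.
    apply: cvgD.
      by apply: (@continuous_comp _ _ _ (fun w : R * R => w.1) (fun x => x ^+ 2)) => //;
         exact: exprn_continuous.
    by apply: (@continuous_comp _ _ _ (fun w : R * R => w.2) (fun x => x ^+ 2)) => //;
       exact: exprn_continuous.
  by move=> w [_ [/ltW]].
(* The closure is taken in the plane, yet it stays in the upper half-plane: y = 0 would give x^2 >=
   1 against 0 <= x <= 1/2. *)
split=> //; rewrite lt_neqAle y0 andbT; apply/negP => /eqP y00.
by move: n1; rewrite -y00; nra.
Qed.

(** The point is moved a fraction e of the way to (1/4, 2), which lies in [DG]. The norm exceeds 1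
    because the second coordinate gains at least e, with h >= 3/4, while the first loses at most e /
    4. *)
Lemma arc_closure k h : 0 <= k <= 2^-1 -> 0 < h -> k ^+ 2 + h ^+ 2 = 1 ->
  closure (@DG R) (k, h).
Proof.
move=> k12 h0 kh B nB.
move: nB => /nbhs_ballP[d /= d0 dB].
pose e := Num.min (d / 4) (1 / 2).
have e0 : 0 < e by rewrite lt_min !divr_gt0.
have e1 : e <= 1 / 2 by rewrite ge_min lexx orbT.
have ed : e <= d / 4 by rewrite ge_min lexx.
have h1 : h <= 1 by nra.
have /andP[k0 k1] := k12.
exists (k + e * (1 / 4 - k), h + e * (2 - h)); split; last first.
  by apply: dB; split => /=; rewrite /ball /= opprD addNKr normrN ltr_norml; nra.
have P1 : 0 < k + e * (1 / 4 - k) by nra.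
have P2 : k + e * (1 / 4 - k) < 2^-1 by nra.
have P3 : k - e / 4 <= k + e * (1 / 4 - k) by nra.
have P4 : h + e <= h + e * (2 - h) by nra.
split => /=; first by lra.
split; last by [].
have P5 : (h + e) ^+ 2 <= (h + e * (2 - h)) ^+ 2 by rewrite lerXn2r ?nnegrE//; lra.
have P6 : (k - e / 4) ^+ 2 <= (k + e * (1 / 4 - k)) ^+ 2 \/ k < e / 4.
  by have [ke|ke] := leP (e / 4) k; [left; rewrite lerXn2r ?nnegrE//; lra|right].
have hk : 3 / 4 <= h ^+ 2 by nra.
have h34 : 3 / 4 <= h by nra.
case: P6 => [P6|P6]; nra.
Qed.

Lemma arc_zeta (n : nat) z : (3 <= n)%nat -> 0 < z.2 -> z.1 ^+ 2 + z.2 ^+ 2 = 1 ->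
  epstein_zeta n%:R z = Num.sqrt (1 - `|z.1| ^+ 2) ^+ n * form_zeta n 1 `|z.1|.
Proof.
move=> n3 z2 z1.
rewrite (epstein_polar n z z.1 z.2 1)//; do ?by rewrite mul1r.
have -> : 1 - `|z.1| ^+ 2 = z.2 ^+ 2 by rewrite real_normK ?num_real//; lra.
rewrite sqrtr_sqr gtr0_norm//; congr (_ * _).
by case: (ler0P z.1) => _ //; rewrite form_zetaN.
Qed.

Lemma arc_energyE b z : 0 < z.2 -> z.1 ^+ 2 + z.2 ^+ 2 = 1 ->
  epstein_zeta 6 z - b * epstein_zeta 3 z = arc_energy b `|z.1|.
Proof. by move=> z2 z1; rewrite (arc_zeta 6)// (arc_zeta 3). Qed.

Lemma energy_ge b z : b <= 306 / 100 -> closure (@DG R) z ->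
  exists2 k, 0 <= k <= 2^-1 &
    arc_energy b k <= epstein_zeta 6 z - b * epstein_zeta 3 z.
Proof.
move=> b306 /closure_DG[y0 n1 x0 x1].
pose r := Num.sqrt (z.1 ^+ 2 + z.2 ^+ 2).
have r2 : r ^+ 2 = z.1 ^+ 2 + z.2 ^+ 2 by rewrite sqr_sqrtr//; lra.
have r1 : 1 <= r by rewrite -sqrtr1 ler_wsqrtr.
have r0 : 0 < r by lra.
pose k := z.1 / r; pose h := z.2 / r.
have z1E : z.1 = r * k by rewrite mulrC divfK// gt_eqF.
have z2E : z.2 = r * h by rewrite mulrC divfK// gt_eqF.
have h0 : 0 < h by rewrite divr_gt0.
have k0 : 0 <= k by rewrite divr_ge0// ltW.
have kh : k ^+ 2 + h ^+ 2 = 1.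
  by rewrite !expr_div_n -mulrDl -r2 divff// sqrf_eq0 gt_eqF.
have kr : 2 * k * r <= 1 by rewrite z1E in x1; lra.
have k1 : k <= 2^-1 by nra.
exists k; first by rewrite k0.
rewrite (epstein_polar 6 z k h r)// (epstein_polar 3 z k h r)//.
apply: le_trans (projection_le k r h b r1 k0 kr h0 kh b306).
rewrite /arc_energy (_ : 1 - k ^+ 2 = h ^+ 2); last by lra.
by rewrite sqrtr_sqr gtr0_norm.
Qed.

End Final.

Theorem theorem4p1 (R : realType) (b : R) :
  b <= 306 / 100 ->
  exists m : R,
    is_min_on (fun z => epstein_zeta 6 z - b * epstein_zeta 3 z) (@closure (R * R)%type DG) m /\
    is_min_on (fun z => epstein_zeta 6 z - b * epstein_zeta 3 z) Gamma_b m.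
Proof.
move=> b306; have [k kI kmin] := arc_energy_min b.
pose h := Num.sqrt (1 - k ^+ 2).
have /andP[k0 k1] := kI.
have k2 : k ^+ 2 <= 1 / 4 by nra.
have h2 : h ^+ 2 = 1 - k ^+ 2 by rewrite sqr_sqrtr//; lra.
have h0 : 0 < h by rewrite sqrtr_gt0; lra.
have kh : k ^+ 2 + h ^+ 2 = 1 by lra.
have fk : epstein_zeta 6 (k, h) - b * epstein_zeta 3 (k, h) = arc_energy b k.
  by rewrite arc_energyE// ger0_norm.
exists (arc_energy b k); split; split.
- by exists (k, h) => //; exact: arc_closure.
- move=> w /(energy_ge b w b306)[k' kI' kw]; exact: le_trans (kmin k' kI') kw.
- exists (k, h) => //; split => //=; split => //; split; last by nra.
  rewrite ler_pdivrMr//.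
  have -> : h * 2 = Num.sqrt ((h * 2) ^+ 2) by rewrite sqrtr_sqr gtr0_norm ?mulr_gt0.
  by rewrite ler_wsqrtr// exprMn h2; lra.
- move=> w [y0 [wn [ys y1]]]; rewrite (arc_energyE b w)//; apply: kmin.
  rewrite normr_ge0 /=.
  have s3 : Num.sqrt 3 ^+ 2 = 3 :> R by rewrite sqr_sqrtr.
  have : 3 / 4 <= w.2 ^+ 2.
    rewrite (_ : 3 / 4 = (Num.sqrt 3 / 2) ^+ 2); last by rewrite expr_div_n s3; field.
    by rewrite lerXn2r ?nnegrE ?divr_ge0 ?sqrtr_ge0// ltW.
  move=> w2; rewrite -ler_sqr ?nnegrE ?invr_ge0// real_normK ?num_real//.
  by rewrite exprVn; lra.
Qed.
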